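(* Almost all cographs have a generalized cospectral mate. That is, if $c_n$ denotes the number of isomorphism classes of cographs on $n$ vertices and $g_n$ the number of those isomorphism classes of cographs $G$ on $n$ vertices for which there exists a graph $H$ (not necessarily a cograph) with $H\not\cong G$, $\mathrm{Spec}(H)=\mathrm{Spec}(G)$ and $\mathrm{Spec}(\overline{H})=\mathrm{Spec}(\overline{G})$, then $g_n/c_n\to 1$ as $n\to\infty$.
   Context: A cograph is a finite simple graph obtained from the single-vertex graph by repeatedly applying disjoint union of two cographs and complementation (equivalently, a graph with no induced path on 4 vertices). $\overline{G}$ denotes the complement of $G$. For a graph $G$ with adjacency matrix $A$, $\mathrm{Spec}(G)$ is the multiset of eigenvalues of $A$. Two graphs $G,H$ are generalized cospectral if $\mathrm{Spec}(G)=\mathrm{Spec}(H)$ and $\mathrm{Spec}(\overline{G})=\mathrm{Spec}(\overline{H})$; a generalized cospectral mate of $G$ is a graph generalized cospectral with $G$ but not isomorphic to it. *)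

(* Defs.v *)
From HB Require Import structures.
From mathcomp Require Import all_boot all_order all_algebra all_fingroup all_field.
From mathcomp Require Import boolp.
Set Implicit Arguments. Unset Strict Implicit. Unset Printing Implicit Defensive.
Import Order.TTheory GRing.Theory Num.Theory.

Definition simpleb n (e : {ffun 'I_n * 'I_n -> bool}) : bool :=
  [forall i : 'I_n, ~~ e (i, i)] && [forall i : 'I_n, forall j : 'I_n, e (i, j) == e (j, i)].

Definition graph n := {e : {ffun 'I_n * 'I_n -> bool} | simpleb e}.

Definition edge n (G : graph n) (i j : 'I_n) : bool := val G (i, j).

Lemma compl_simple n (G : graph n) :
  simpleb [ffun ij : 'I_n * 'I_n => (ij.1 != ij.2) && ~~ val G ij].
Proof.
case: G => e /= /andP [_ Hs]; apply/andP; split.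
  by apply/forallP => i; rewrite ffunE /= eqxx.
apply/forallP => i; apply/forallP => j; rewrite !ffunE /=.
have /forallP /(_ j) /eqP -> := forallP Hs i.
by rewrite (eq_sym j i).
Qed.

Definition compl n (G : graph n) : graph n := exist (fun e => simpleb e) _ (compl_simple G).

Definition iso n (G H : graph n) : Prop :=
  exists s : 'S_n, forall i j : 'I_n, edge H (s i) (s j) = edge G i j.

Definition adj n (G : graph n) : 'M[algC]_n := \matrix_(i, j) (edge G i j)%:R%R.

Definition same_spec n (G H : graph n) : Prop :=
  forall z : algC, mup z (char_poly (adj G)) = mup z (char_poly (adj H)).

Definition gen_cospectral n (G H : graph n) : Prop :=
  same_spec G H /\ same_spec (compl G) (compl H).

Definition has_gen_cospectral_mate n (G : graph n) : Prop :=
  exists H : graph n, ~ iso G H /\ gen_cospectral G H.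

Definition cograph n (G : graph n) : Prop :=
  ~ exists a b c d : 'I_n,
      [/\ uniq [:: a; b; c; d],
          [&& edge G a b, edge G b c & edge G c d] &
          [&& ~~ edge G a c, ~~ edge G b d & ~~ edge G a d]].

Definition iso_class n (G : graph n) : {set graph n} :=
  [set H | `[< iso G H >]].

Definition c_count n : nat :=
  #|[set iso_class G | G in [set G : graph n | `[< cograph G >]]]|.

Definition g_count n : nat :=
  #|[set iso_class G | G in
      [set G : graph n | `[< cograph G >] && `[< has_gen_cospectral_mate G >]]]|.

(* Main.v *)
Require Import Defs.
From HB Require Import structures.
From mathcomp Require Import all_boot all_order all_algebra all_fingroup all_field.
From mathcomp Require Import boolp zify ring lra.
Import Order.TTheory GRing.Theory Num.Theory.
Set Implicit Arguments. Unset Strict Implicit. Unset Printing Implicit Defensive.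

(* A graph without induced path on four vertices, or its complement, is disconnected,
   so cographs on n vertices correspond to forests of unordered cotrees with n leaves.
   The cotree [swap_limb] and another one, [swapped_limb], give generalized cospectral
   graphs, and this relation is preserved by disjoint union and complement: replacing a
   subtree [swap_limb] in the cotree of a cograph by [swapped_limb] yields a mate, since
   cotrees are determined by their graphs. It remains to see that forests avoiding
   [swap_limb] are negligible. Writing C(x) = sum_(n >= 1) c_n x^n for all forests and F
   for those avoiding the subtree, counting pairs (forest, leaf) gives
   x C' = (1 + C)(x + 2 R) / (1 - C), with R regular beyond the critical point x0 where
   C(x0) = 1, and x F' <= (1 + F)(x + 2 R) / (1 - F). As F(x0) < C(x0) = 1, the second
   relation bounds F at some y > x0, so f_n = O(y^-n), while the first one gives
   c_n >= d x1^-n / n for each x1 > x0. *)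

(** * Comparison of power series *)

(** Putting a root above a forest of at least two trees gives a tree, so the series T of all trees
    satisfies 2 T = C + x. With the limb forbidden, the new root may create it, and for the series B
    of avoiding trees only 2 B <= F + x survives, which is the direction needed. Counting pairs
    yields x C' = (1 + C) sum_(i >= 1) x^i T'(x^i). The term i = 1 equals (x C' + x) / 2; solving
    for x C' produces the division by 1 - C, and R collects the terms i >= 2, where the powers of x
    stay away from the singularity. No limit is taken: partial sums at points of an ordered field
    replace the series. Hence F(x0) < C(x0) is used as an explicit gap 8^-m, where m is the number
    of leaves of the limb, and y may exceed the critical point by a small multiple of the square of
    this gap. *)

Section Analysis.

Local Open Scope ring_scope.

Variable R : archiRealFieldType.

Definition psum (g : nat -> nat) N (x : R) : R :=
  \sum_(1 <= n < N.+1) (g n)%:R * x ^+ n.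

Lemma psum_ge0 g N x : 0 <= x -> 0 <= psum g N x.
Proof. by move=> x0; apply: sumr_ge0 => i _; rewrite mulr_ge0 ?exprn_ge0. Qed.

Lemma psum_mono g N M x : 0 <= x -> (N <= M)%N -> psum g N x <= psum g M x.
Proof.
move=> x0 NM; rewrite /psum (big_cat_nat (n := N.+1) _ _ (p := M.+1)) //=.
by rewrite lerDl; apply: sumr_ge0 => i _; rewrite mulr_ge0 ?exprn_ge0.
Qed.

Lemma psum_term g N n x : 0 <= x -> (0 < n <= N)%N ->
  (g n)%:R * x ^+ n <= psum g N x.
Proof.
move=> x0 /andP[n0 nN]; apply: le_trans (psum_mono g x0 nN).
rewrite /psum big_nat_recr //= lerDr.
by apply: sumr_ge0 => i _; rewrite mulr_ge0 ?exprn_ge0.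
Qed.

(** Both indices are at least 1, so the triangle j + k <= N + 1 lies in the square j, k <= N. The
    drop from N + 1 on the left to N on the right is what closes the inductions on the truncation
    order below. *)
Lemma convolution_le (u v : nat -> R) N :
  (forall n, 0 <= u n) -> (forall n, 0 <= v n) ->
  \sum_(1 <= n < N.+2) \sum_(1 <= j < n) u j * v (n - j)%N
  <= (\sum_(1 <= j < N.+1) u j) * (\sum_(1 <= j < N.+1) v j).
Proof.
move=> u0 v0.
rewrite (eq_big_nat _ _ (F2 := fun n =>
    \sum_(1 <= j < N.+2 | (j < n)%N) u j * v (n - j)%N)); last first.
  by move=> n /andP[_ nN]; rewrite (big_nat_widen _ _ N.+2) ?(ltnW nN).
rewrite (exchange_big_dep_nat xpredT) //=.
rewrite big_distrl /= big_nat_recr //= [X in _ + X <= _](_ : _ = 0) ?addr0; last first.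
  by rewrite big_nat_cond big_pred0 // => i; apply/negbTE; lia.
apply: ler_sum_nat => j /andP[j1 jN].
rewrite -big_distrr /=; apply: ler_wpM2l => //.
rewrite (eq_bigl (fun i => xpredT i && (j < i)%N)) // -(big_nat_widenl j.+1 1) //.
rewrite -[j.+1]addn1 addnC big_addn.
rewrite (eq_bigr v); last by move=> i _; rewrite addnK.
rewrite [leRHS](@big_cat_nat _ _ _ (N.+2 - j)%N) /=; [|lia|lia].
by rewrite lerDl sumr_ge0.
Qed.

(** A mean value bound; the derivative is written n y^n / y to match the weights [n * f n] used
    later. *)
Lemma expr_diff_le (x y : R) n : 0 < x <= y ->
  y ^+ n <= x ^+ n + (y - x) / y * (n%:R * y ^+ n).
Proof.
move=> /andP[x0 xy]; have y0 : 0 < y by lra.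
elim: n => [|n IH]; first by rewrite !expr0 mul0r mulr0 addr0.
rewrite !exprS -[n.+1]addn1 natrD.
have h1 : x ^+ n <= y ^+ n by rewrite lerXn2r ?nnegrE //; lra.
have h2 : y * y ^+ n <= y * (x ^+ n + (y - x) / y * (n%:R * y ^+ n)).
  by rewrite ler_wpM2l // ltW.
apply: le_trans h2 _.
have -> : x * x ^+ n + (y - x) / y * ((n%:R + 1%:R) * (y * y ^+ n)) =
  x * x ^+ n + (y - x) * y ^+ n + y * ((y - x) / y * (n%:R * y ^+ n)).
  by field; rewrite gt_eqF.
rewrite mulrDr lerD2r.
suff : 0 <= (y - x) * (y ^+ n - x ^+ n) by lra.
by rewrite mulr_ge0 // subr_ge0.
Qed.

(** With 1/w = 1 + h, the expansion of (1 + h)^n is kept to second order: the term n (n - 1) h^2 / 2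
    beats the factor n, which the linear Bernoulli bound does not. *)
Lemma geometric_decay (w e : R) : 0 < w < 1 -> 0 < e ->
  exists N : nat, forall n, (N <= n)%N -> n%:R * w ^+ n < e.
Proof.
move=> /andP[w0 w1] e0; pose h := w^-1 - 1.
have h0 : 0 < h by rewrite subr_gt0 invf_gt1.
have wh : w * (1 + h) = 1 by rewrite /h addrC subrK divff // gt_eqF.
have bern n : 1 + n%:R * h + n%:R * (n%:R - 1) / 2%:R * h ^+ 2 <= (1 + h) ^+ n.
  elim: n => [|n IH]; first by rewrite expr0; lra.
  have := @ler_wpM2l _ (1 + h) _ _ _ IH; rewrite -exprS => /(_ ltac:(lra)).
  apply: le_trans; rewrite -[n.+1]addn1 natrD.
  suff : 0 <= n%:R * (n%:R - 1) / 2%:R * h ^+ 3 by rewrite !expr2 !exprS expr0; lra.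
  case: n {IH} => [|n]; first by rewrite !mul0r.
  rewrite -[n.+1]addn1 natrD addrK mulr_ge0 ?exprn_ge0 ?(ltW h0) //.
  by rewrite divr_ge0 // mulr_ge0 // addr_ge0.
pose M := Num.Def.archi_bound (2%:R / (e * h ^+ 2)).
have MP : 2%:R / (e * h ^+ 2) < M%:R.
  by apply: archi_boundP; rewrite divr_ge0 // mulr_ge0 ?exprn_ge0 // ltW.
exists M.+2 => n Mn.
have n1 : M%:R + 1 <= n%:R - 1 :> R.
  have : (M + 2)%:R <= n%:R :> R by rewrite ler_nat addn2.
  by rewrite natrD; lra.
have hh : 0 < h ^+ 2 by rewrite exprn_gt0.
have key : n%:R < e * (1 + h) ^+ n.
  have n0 : 0 < n%:R :> R by rewrite ltr0n; lia.
  have : e * (n%:R * (n%:R - 1) / 2%:R * h ^+ 2) <= e * (1 + h) ^+ n.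
    apply: ler_wpM2l; first exact: ltW.
    by apply: le_trans (bern n); rewrite lerDr addr_ge0 // mulr_ge0 ?ltW.
  apply: lt_le_trans.
  have : 2%:R < e * h ^+ 2 * (n%:R - 1).
    rewrite -ltr_pdivrMl ?mulr_gt0 // mulrC; lra.
  move=> h2; have -> : e * (n%:R * (n%:R - 1) / 2%:R * h ^+ 2) =
    n%:R * ((e * h ^+ 2 * (n%:R - 1)) / 2%:R) by field.
  by rewrite ltr_pMr //; lra.
have -> : e = e * (1 + h) ^+ n * w ^+ n.
  by rewrite -mulrA -exprMn [(1 + h) * w]mulrC wh expr1n mulr1.
by rewrite ltr_pM2r // exprn_gt0.
Qed.

(** * Avoiding forests against all forests *)

Section Comparison.

(** In the application [c] and [t] count all canonical forests and trees by leaves, [f] and [b]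
    those avoiding the limb, and [m] is the number of leaves of the limb. *)
Variables c f b t : nat -> nat.
Variable m : nat.
Hypotheses (c0 : c 0 = 1%N) (f0 : f 0 = 1%N).
Hypothesis c_gt0 : forall n, (0 < n)%N -> (0 < c n)%N.
Hypothesis c_ge_conv :
  forall n, (\sum_(1 <= k < n) k * c k * c (n - k) <= n * c n)%N.
Hypothesis c_le_t : forall n, (0 < n)%N -> (c n <= 2 * t n)%N.
Hypothesis t1 : (t 1 <= 1)%N.
Hypothesis t_le_conv :
  forall n, (1 < n)%N -> (t n <= \sum_(1 <= j < n) t j * c (n - j))%N.
Hypothesis f_le_c : forall n, (f n <= c n)%N.
Hypotheses (m_gt0 : (0 < m)%N) (f_lt_c : (f m < c m)%N).
Hypothesis b_le_f : forall n, (0 < n)%N -> (2 * b n <= f n + (n == 1))%N.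
Hypothesis f_le_euler : forall n, (0 < n)%N ->
  (n * f n <= \sum_(1 <= d < n.+1) \sum_(1 <= i < n.+1 | i * d <= n)
                d * b d * f (n - i * d))%N.

(** From T <= x + T C and C <= 2 T follows T <= x + 2 T^2, and at x = 1/8 the equation T = x + 2 T^2
    has the double root T = 1/4. *)
Lemma psum_t_le N : psum t N (8%:R^-1) <= 4%:R^-1 :> R.
Proof.
have x0 : (0 : R) <= 8%:R^-1 by lra.
elim: N => [|N IH]; first by rewrite /psum big_geq //; lra.
pose x : R := 8%:R^-1.
have cs M : psum c M x <= 2%:R * psum t M x.
  rewrite /psum big_distrr /=; apply: ler_sum_nat => n /andP[n1 _].
  by rewrite mulrA ler_wpM2r ?exprn_ge0 // -natrM ler_nat c_le_t.
rewrite -/x /psum big_ltn //.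
have h1 : (t 1)%:R * x ^+ 1 <= 8%:R^-1.
  by rewrite expr1 ler_piMl // -[1]/(1%:R) ler_nat.
have h2 : \sum_(2 <= i < N.+2) (t i)%:R * x ^+ i <= psum t N x * psum c N x.
  rewrite /psum; apply: le_trans (convolution_le _ _ _); last first.
  - by move=> n; rewrite mulr_ge0 ?exprn_ge0.
  - by move=> n; rewrite mulr_ge0 ?exprn_ge0.
  rewrite [leRHS]big_ltn // [X in _ <= X + _]big_geq // add0r; apply: ler_sum_nat => n /andP[n1 _].
  have := t_le_conv n1; rewrite -(ler_nat R) natr_sum.
  move=> /(ler_wpM2r (exprn_ge0 n x0)) /le_trans; apply.
  rewrite big_distrl /=; apply: ler_sum_nat => j /andP[j1 jn].
  by rewrite natrM -[X in _ * x ^+ X <= _](subnKC (ltnW jn)) exprD le_eqVlt; apply/orP; left; apply/eqP; ring.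
have h3 := psum_ge0 t N x0; have h4 := psum_ge0 c N x0.
have h5 : psum t N x * psum c N x <= 4%:R^-1 * 2%:R^-1.
  by apply: ler_pM => //; have := cs N; rewrite -/x in IH *; lra.
lra.
Qed.

Lemma psum_c_le N : psum c N (8%:R^-1) <= 1 :> R.
Proof.
have x0 : (0 : R) <= 8%:R^-1 by lra.
have := psum_t_le N; apply: contraTT; rewrite -!ltNge => /lt_le_trans h.
suff : psum c N (8%:R^-1) <= 2%:R * psum t N (8%:R^-1) by move=> /h; lra.
rewrite /psum big_distrr /=; apply: ler_sum_nat => n /andP[n1 _].
by rewrite mulrA ler_wpM2r ?exprn_ge0 // -natrM ler_nat c_le_t.
Qed.

(** The bound [c n >= 1] suffices, as 3/5 + 9/25 + 27/125 > 1. A critical point below 3/5 leaves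
    room for some y beyond it with y^2 <= (3/4) x. *)
Lemma psum_c_gt : 1 < psum c 3 (3%:R / 5%:R) :> R.
Proof.
have h n : (0 < n)%N -> 1 <= (c n)%:R :> R.
  by move=> /c_gt0; rewrite -(ler_nat R).
rewrite /psum 3?big_nat_recr //= big_geq // add0r !exprS expr0.
by have := h 1%N isT; have := h 2%N isT; have := h 3%N isT; lra.
Qed.

(* The critical point of [c] need not exist in [R], so it is only located up to [e]. *)
Lemma critical_grid (e : R) : 0 < e ->
  exists2 x : R, 8%:R^-1 <= x < 3%:R / 5%:R &
    (forall N, psum c N x <= 1) /\ exists N, 1 < psum c N (x + e).
Proof.
move=> e0; pose P x := `[< forall N, psum c N x <= 1 >].
have PN x : ~~ P x -> exists N, 1 < psum c N x.
  move=> /asboolPn /existsNP[N /negP]; rewrite -ltNge; by exists N.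
have exj : exists j, ~~ P (8%:R^-1 + j%:R * e).
  pose j := Num.Def.archi_bound e^-1; exists j.
  apply/asboolPn => /(_ 3%N); apply/negP; rewrite -ltNge.
  apply: lt_le_trans psum_c_gt _.
  have je : 1 < j%:R * e.
    by rewrite -ltr_pdivrMr // div1r archi_boundP // invr_ge0 ltW.
  rewrite /psum; apply: ler_sum_nat => n _; apply: ler_wpM2l => //.
  by rewrite lerXn2r ?nnegrE //; lra.
case: (ex_minnP exj) => -[|j] Pj minj.
  by move: Pj; rewrite mul0r addr0 => /asboolPn[]; apply: psum_c_le.
have [Pj'|/minj] := boolP (P (8%:R^-1 + j%:R * e)); last by rewrite ltnn.
have je0 : 0 <= j%:R * e by rewrite mulr_ge0 // ltW.
exists (8%:R^-1 + j%:R * e).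
  rewrite lerDl je0 /= ltNge; apply/negP => h.
  move/asboolP: Pj' => /(_ 3%N); apply/negP; rewrite -ltNge.
  apply: lt_le_trans psum_c_gt _.
  rewrite /psum; apply: ler_sum_nat => n _; apply: ler_wpM2l => //.
  by rewrite lerXn2r ?nnegrE //; lra.
split; first exact/asboolP.
suff -> : 8%:R^-1 + j%:R * e + e = 8%:R^-1 + j.+1%:R * e by apply: PN.
by rewrite -natr1; ring.
Qed.

(** Put u_n = n c_n x^n. By the convolution bound, u_n >= sum_(k <= N) c_k x^k u_(n - k) for n > N.
    The weights sum to more than 1, so a lower bound valid up to N persists; x^N is one, because c_n
    >= 1 and x < 1. *)
Lemma c_lower (x : R) N : 0 < x < 1 -> 1 < psum c N x ->
  exists2 d, 0 < d & forall n, (0 < n)%N -> d <= n%:R * (c n)%:R * x ^+ n.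
Proof.
move=> /andP[x0 x1] cN; exists (x ^+ N); first by rewrite exprn_gt0.
elim/ltn_ind => n IH n0.
have [nN|Nn] := leqP n N.
  have h : 1 <= n%:R * (c n)%:R :> R.
    by rewrite -natrM -[1]/(1%:R) ler_nat muln_gt0 n0 c_gt0.
  apply: (@le_trans _ _ (x ^+ n)).
    by rewrite ler_wiXn2l // ltW.
  by rewrite ler_peMl // exprn_ge0 // ltW.
have := c_ge_conv n; rewrite -(ler_nat R) natrM natr_sum.
have xn0 := exprn_ge0 n (ltW x0).
move=> /(ler_wpM2r xn0); apply: le_trans.
rewrite big_distrl /=.
apply: (@le_trans _ _ (x ^+ N * psum c N x)).
  by rewrite ler_peMr ?exprn_ge0 // ltW.
(* After the reversal the factor of bounded index carries the weights c_k x^k, and the terms k > N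
   are dropped. *)
rewrite big_nat_rev /= /psum big_distrr /=.
rewrite [leRHS](@big_cat_nat _ _ _ N.+1) //= -[leLHS]addr0; apply: lerD.
  apply: ler_sum_nat => k /andP[k1 kN].
  rewrite (_ : 1 + n - k.+1 = n - k)%N; last by lia.
  rewrite subKn; last by lia.
  have := IH (n - k)%N ltac:(lia) ltac:(lia).
  have ck : 0 <= (c k)%:R * x ^+ k by rewrite mulr_ge0 // exprn_ge0 // ltW.
  move=> /(ler_wpM2l ck); rewrite mulrC => /le_trans; apply.
  have -> : x ^+ n = x ^+ (n - k) * x ^+ k by rewrite -exprD subnK //; lia.
  rewrite !natrM.
  by rewrite le_eqVlt; apply/orP; left; apply/eqP; ring.
by apply: sumr_ge0 => k _; rewrite mulr_ge0.
Qed.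

Lemma b_le_c n : (0 < n)%N -> (b n <= c n)%N.
Proof.
move=> n0; have := b_le_f n0; have := f_le_c n; have := c_gt0 n0; lia.
Qed.

(** The bound on [2 * b d] is applied to the terms i = 1 of the doubled inequality. Its part at d =
    n is n f_n, because f_0 = 1, and cancels one of the two copies on the left; the correction at d
    = 1 contributes [f n.-1]. *)
Lemma f_recurrence n : (0 < n)%N ->
  (n * f n <= \sum_(1 <= d < n) d * f d * f (n - d) + f n.-1 +
     2 * \sum_(1 <= d < n.+1) \sum_(2 <= i < n.+1 | i * d <= n)
            d * b d * f (n - i * d))%N.
Proof.
move=> n0; have := f_le_euler n0.
set E := (\sum_(1 <= d < n.+1) \sum_(1 <= i < n.+1 | _) _)%N.
set H := (\sum_(1 <= d < n.+1) \sum_(2 <= i < n.+1 | _) _)%N => hE.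
have EH : E = (\sum_(1 <= d < n.+1) d * b d * f (n - d) + H)%N.
  rewrite /E /H -big_split /=; apply: eq_big_nat => d /andP[d1 dn].
  by rewrite [LHS]big_mkcond big_ltn //= mul1n -ltnS dn -big_mkcond.
have : (2 * \sum_(1 <= d < n.+1) d * b d * f (n - d) <=
   \sum_(1 <= d < n.+1) d * f d * f (n - d) + f n.-1)%N.
  apply: (@leq_trans (\sum_(1 <= d < n.+1) (d * f d * f (n - d) + (d == 1) * f (n - d)))).
    rewrite big_distrr /= big_nat_cond [leqRHS]big_nat_cond.
    apply: leq_sum => d /andP[/andP[d1 _] _].
    rewrite -mulnDl !mulnA leq_mul2r; apply/orP; right.
    by have := b_le_f d1; case: eqP => [->|_]; nia.
  rewrite big_split /= leq_add2l big_ltn // eqxx mul1n subn1.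
  rewrite big_nat_cond big1 ?addn0 // => i /andP[/andP[i1 _] _].
  by rewrite gtn_eqF.
rewrite [X in (_ <= X + _)%N]big_nat_recr //= subnn f0 muln1 => h.
move: hE; rewrite EH -(leq_pmul2l (isT : 0 < 2)%N) mulnDr; move: h.
set Sb := (2 * \sum_(1 <= d < n.+1) _)%N; set Sf := (\sum_(1 <= d < n) _)%N.
lia.
Qed.

Section Bounded.

Variables x y : R.
Hypotheses (x_ge : 8%:R^-1 <= x) (xy : x <= y) (y_lt : y < 3%:R / 4%:R).
Hypothesis y2x : y ^+ 2 <= 3%:R / 4%:R * x.
Hypothesis cx : forall N, psum c N x <= 1.

Let x_gt0 : 0 < x. Proof. by apply: lt_le_trans x_ge; rewrite invr_gt0 ltr0n. Qed.
Let y_gt0 : 0 < y. Proof. exact: lt_le_trans x_gt0 xy. Qed.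

(** This is the regularity of R beyond the critical point. The sum over i >= 2 of y^(i d) is at most
    4 y^(2 d) <= 4 (3/4)^d x^d, and d (3/4)^d <= 4 absorbs the weight d. What remains is 16 times a
    partial sum of [c] at x, which is at most 1. *)
Lemma tail_euler_le N :
  \sum_(1 <= d < N) \sum_(2 <= i < N) (d * b d)%:R * y ^+ (i * d) <= 16%:R.
Proof.
have [hx hxy hy] := And3 x_ge xy y_lt.
have geo (z : R) M : 0 <= z <= 3%:R / 4%:R ->
    \sum_(2 <= i < M) z ^+ i <= 4%:R * z ^+ 2.
  move=> /andP[z0 z1]; have z2 : 0 <= z ^+ 2 by rewrite exprn_ge0.
  suff : (1 - z) * \sum_(2 <= i < M) z ^+ i <= z ^+ 2.
    by have : 0 <= \sum_(2 <= i < M) z ^+ i by [apply: sumr_ge0 => i _; rewrite exprn_ge0]; nra.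
  have [M2|M2] := leqP M 2; first by rewrite big_geq // mulr0.
  rewrite big_distrr /= (eq_bigr (fun i => - (z ^+ i.+1 - z ^+ i))); last first.
    by move=> i _; rewrite exprS; ring.
  rewrite sumrN telescope_sumr 1?ltnW // opprB lerBlDr lerDl exprn_ge0 //.
have lin (n : nat) : n%:R * (3%:R / 4%:R) ^+ n <= 4%:R :> R.
  suff : n%:R * (3%:R / 4%:R) ^+ n <= 4%:R - 4%:R * (3%:R / 4%:R) ^+ n :> R.
    by move/le_trans; apply; rewrite gerBl mulr_ge0 // exprn_ge0 //; lra.
  elim: n => [|n IH]; first by rewrite expr0; lra.
  rewrite -natr1 exprS.
  have : (3%:R / 4%:R) ^+ n <= 1 :> R by rewrite exprn_ile1 //; lra.
  by move: IH; set w := _ ^+ n; lra.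
apply: (@le_trans _ _ (16%:R * psum c N x)); last first.
  by rewrite ler_piMr.
apply: (@le_trans _ _ (\sum_(1 <= d < N) 16%:R * ((c d)%:R * x ^+ d))); last first.
  rewrite /psum big_distrr /=; case: N => [|N]; first by rewrite !big_geq.
  by rewrite [leRHS]big_nat_recr //= lerDl !mulr_ge0 // exprn_ge0 // ltW.
apply: ler_sum_nat => d /andP[d1 _].
rewrite -big_distrr /=.
rewrite (eq_bigr (fun i => (y ^+ d) ^+ i)); last by move=> i _; rewrite mulnC exprM.
have yd : 0 <= y ^+ d <= 3%:R / 4%:R.
  rewrite exprn_ge0 ?(ltW y_gt0) //= -[d]prednK // exprS.
  apply: (@le_trans _ _ (y * 1)); last by lra.
  by apply: ler_wpM2l; rewrite ?exprn_ile1 //; lra.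
have h0 : 0 <= (d * b d)%:R :> R by [].
apply: le_trans (ler_wpM2l h0 (geo _ N yd)) _.
have h1 : y ^+ d ^+ 2 <= (3%:R / 4%:R) ^+ d * x ^+ d.
  rewrite -exprM mulnC exprM -exprMn lerXn2r ?nnegrE ?exprn_ge0 //.
  - exact: ltW.
  - by rewrite mulr_ge0 //; lra.
have xd : 0 <= x ^+ d by rewrite exprn_ge0 // ltW.
have bc : (b d)%:R <= (c d)%:R :> R by rewrite ler_nat b_le_c.
have h2 : (b d)%:R * x ^+ d <= (c d)%:R * x ^+ d by rewrite ler_wpM2r.
have b0 : 0 <= (b d)%:R * x ^+ d by rewrite mulr_ge0.
apply: (@le_trans _ _ ((d * b d)%:R * (4%:R * ((3%:R / 4%:R) ^+ d * x ^+ d)))).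
  by apply: ler_wpM2l => //; apply: ler_wpM2l.
rewrite natrM.
have -> : d%:R * (b d)%:R * (4%:R * ((3%:R / 4%:R) ^+ d * x ^+ d)) =
   4%:R * (d%:R * (3%:R / 4%:R) ^+ d) * ((b d)%:R * x ^+ d) by ring.
have := ler_wpM2r b0 (lin d); lra.
Qed.

(** Truncated form of x F' <= x F' F + (1 + F) (x + 2 R), with 33 = 1 + 2 * 16 from y <= 1 and R <=
    16. The right side only involves the order N, so the bound can drive an induction. *)
Lemma weighted_psum_step N :
  psum (fun n => n * f n)%N N.+1 y <=
  psum (fun n => n * f n)%N N y * psum f N y + (1 + psum f N y) * 33%:R.
Proof.
have [hx hxy hy] := And3 x_ge xy y_lt.
have y0 := ltW y_gt0.
have pos n : 0 <= y ^+ n by rewrite exprn_ge0.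
pose A n := (\sum_(1 <= d < n) d * f d * f (n - d))%N.
pose B n := (\sum_(1 <= d < n.+1) \sum_(2 <= i < n.+1 | i * d <= n)
            d * b d * f (n - i * d))%N.
have : psum (fun n => n * f n)%N N.+1 y <=
  psum A N.+1 y + psum (fun n => f n.-1) N.+1 y + 2%:R * psum B N.+1 y.
  rewrite /psum big_distrr -!big_split /=; apply: ler_sum_nat => n /andP[n1 _].
  have := f_recurrence n1; rewrite -(ler_nat R) => /(ler_wpM2r (pos n)).
  by rewrite -/(A n) -/(B n) !natrD natrM; move/le_trans; apply; lra.
move/le_trans; apply.
have hA : psum A N.+1 y <= psum (fun n => n * f n)%N N y * psum f N y.
  rewrite /psum; apply: le_trans (convolution_le _ _ _); last first.
  - by move=> n; rewrite mulr_ge0.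
  - by move=> n; rewrite mulr_ge0.
  apply: ler_sum_nat => n /andP[n1 _].
  rewrite natr_sum big_distrl /=; apply: ler_sum_nat => j /andP[j1 jn].
  rewrite !natrM -[X in _ * y ^+ X <= _](subnKC (ltnW jn)) exprD.
  by rewrite le_eqVlt; apply/orP; left; apply/eqP; ring.
have f1 M : 1 + psum f M y = \sum_(0 <= k < M.+1) (f k)%:R * y ^+ k.
  by rewrite big_ltn // f0 expr0 mulr1.
have hf : psum (fun n => f n.-1) N.+1 y = y * (1 + psum f N y).
  rewrite f1 /psum big_add1 /= big_distrr /=; apply: eq_big_nat => n _.
  by rewrite exprS; ring.
have hB : psum B N.+1 y <= 16%:R * (1 + psum f N y).
  apply: (@le_trans _ _ ((\sum_(1 <= d < N.+2) \sum_(2 <= i < N.+2)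
       (d * b d)%:R * y ^+ (i * d)) * (1 + psum f N y))); last first.
    by apply: ler_wpM2r (tail_euler_le _); rewrite addr_ge0 // psum_ge0.
  rewrite /psum /B.
  rewrite (eq_big_nat _ _ (F2 := fun n => \sum_(1 <= d < N.+2)
     \sum_(2 <= i < N.+2) if (i * d <= n)%N then
       ((d * b d)%:R * y ^+ (i * d)) * ((f (n - i * d))%:R * y ^+ (n - i * d)) else 0));
    last first.
    move=> n /andP[n1 nN]; rewrite natr_sum big_distrl /=.
    rewrite [RHS](@big_cat_nat _ _ _ n.+1) //= [X in _ = _ + X]big_nat_cond.
    rewrite [X in _ = _ + X]big1 ?addr0; last first.
      move=> d /andP[/andP[d1 _] _]; rewrite big_nat_cond big1 // => i.
      by move=> /andP[/andP[i1 _] _]; case: ifP => //; nia.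
    apply: eq_big_nat => d /andP[d1 _]; rewrite natr_sum big_distrl /=.
    rewrite -big_mkcond /= [RHS]big_nat_cond [LHS]big_nat_cond.
    rewrite [RHS](@big_nat_widenl _ _ _ 2 0) // [LHS](@big_nat_widenl _ _ _ 2 0) //.
    rewrite (@big_nat_widen _ _ _ 0 n.+1 N.+2) //.
    apply: eq_big => [i|i]; first by nia.
    move=> /andP[/andP[/andP[_ h] _] _].
    by rewrite !natrM -[X in _ * y ^+ X = _](subnKC h) exprD; ring.
  rewrite exchange_big /= big_distrl /=; apply: ler_sum_nat => d /andP[d1 _].
  rewrite exchange_big /= big_distrl /=; apply: ler_sum_nat => i /andP[i1 _].
  rewrite -big_mkcond /= -big_distrr /=; apply: ler_wpM2l; first by rewrite mulr_ge0.
  rewrite f1.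
  have id0 : (0 < i * d)%N by rewrite muln_gt0 d1; lia.
  have [idN|Nid] := leqP (i * d) N.+1; last first.
    rewrite big_nat_cond big1; first by apply: sumr_ge0 => *; rewrite mulr_ge0.
    by move=> k; lia.
  rewrite (eq_bigl (fun k => xpredT k && (i * d <= k)%N)) // -big_nat_widenl //.
  rewrite -{1}[(i * d)%N]add0n big_addn.
  rewrite (eq_bigr (fun k => (f k)%:R * y ^+ k)); last by move=> k _; rewrite addnK.
  rewrite [leRHS](@big_cat_nat _ _ _ (N.+2 - i * d)%N) /=; [|lia|lia].
  by rewrite lerDl sumr_ge0 // => *; rewrite mulr_ge0.
have := psum_ge0 f N y0; rewrite hf => s0.
have : y * (1 + psum f N y) <= 1 * (1 + psum f N y) by apply: ler_wpM2r; lra.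
lra.
Qed.

(** The coefficients differ by at least 1 at index m, and x^m >= 8^-m. *)
Lemma psum_f_lt_c N : psum f N x <= 1 - 8%:R^-1 ^+ m.
Proof.
have [hx hxy hy] := And3 x_ge xy y_lt.
have x0 := ltW x_gt0.
(* The truncation order may be below m, so it is raised until the strict coefficient occurs. *)
apply: le_trans (psum_mono f x0 (leq_maxl N m)) _.
apply: (@le_trans _ _ (psum c (maxn N m) x - x ^+ m)); last first.
  apply: lerB; first exact: cx.
  by rewrite lerXn2r ?nnegrE //; lra.
rewrite lerBrDr /psum.
have mem : m \in index_iota 1 (maxn N m).+1 by rewrite mem_index_iota m_gt0 ltnS leq_maxr.
rewrite (bigD1_seq m) ?iota_uniq //= [leRHS](bigD1_seq m) ?iota_uniq //=.
rewrite addrAC; apply: lerD.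
  rewrite -{2}[x ^+ m]mul1r -mulrDl ler_wpM2r ?exprn_ge0 //.
  by rewrite natr1 ler_nat.
by apply: ler_sum => n _; rewrite ler_wpM2r ?exprn_ge0 // ler_nat.
Qed.

(** A bootstrap on N. If F <= 1 - eta/2 and x F' <= 132/eta at y, the recurrence gives x F' <=
    (132/eta) (1 - eta/2) + 66 = 132/eta at the next order. The mean value bound then gives F(y) <=
    F(x) + (eta^2/264) (132/eta) <= 1 - eta + eta/2. The constant is 2112 = 8 * 264, since (y - x) /
    y <= 8 (y - x). *)
Lemma psum_f_bounded : y - x <= (8%:R^-1 ^+ m) ^+ 2 / 2112%:R ->
  forall N, psum f N y <= 1.
Proof.
have [hx hxy hy] := And3 x_ge xy y_lt.
set eta : R := _ ^+ m => hyx.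
have eta0 : 0 < eta by rewrite exprn_gt0 //; lra.
have eta1 : eta <= 1 by rewrite exprn_ile1 //; lra.
suff H N : psum f N y <= 1 - eta / 2%:R /\
    psum (fun n => n * f n)%N N y <= 132%:R / eta.
  by move=> N; have [] := H N; lra.
elim: N => [|N [IH1 IH2]].
  by rewrite /psum !big_geq //; split; [lra|rewrite divr_ge0 // ltW].
have s0 := psum_ge0 f N (ltW y_gt0).
have s1 := psum_ge0 (fun n => n * f n)%N N (ltW y_gt0).
have D : psum (fun n => n * f n)%N N.+1 y <= 132%:R / eta.
  apply: le_trans (weighted_psum_step N) _.
  have h1 : psum (fun n => n * f n)%N N y * psum f N y <=
    132%:R / eta * (1 - eta / 2%:R) by apply: ler_pM.
  have h2 : 132%:R / eta * (1 - eta / 2%:R) = 132%:R / eta - 66%:R.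
    by field; rewrite gt_eqF.
  lra.
split=> //.
have : psum f N.+1 y <= psum f N.+1 x + (y - x) / y * psum (fun n => n * f n)%N N.+1 y.
  rewrite /psum big_distrr -big_split /=; apply: ler_sum_nat => n _.
  have := @expr_diff_le x y n; rewrite x_gt0 xy => /(_ isT).
  move=> /(ler_wpM2l (ler0n R (f n))); rewrite natrM; move/le_trans; apply.
  by rewrite le_eqVlt; apply/orP; left; apply/eqP; ring.
move/le_trans; apply; have := psum_f_lt_c N.+1; rewrite -/eta => h.
have hyy : (y - x) / y <= eta ^+ 2 / 264%:R.
  rewrite ler_pdivrMr //; apply: le_trans hyx _.
  have e2 : 0 <= eta ^+ 2 by rewrite exprn_ge0 // ltW.
  have : eta ^+ 2 * 8%:R^-1 <= eta ^+ 2 * y by apply: ler_wpM2l => //; lra.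
  lra.
have : (y - x) / y * psum (fun n => n * f n)%N N.+1 y <=
    eta ^+ 2 / 264%:R * (132%:R / eta).
  apply: ler_pM => //; last exact: psum_ge0 (ltW y_gt0).
  by rewrite divr_ge0 ?subr_ge0 // ltW.
have -> : eta ^+ 2 / 264%:R * (132%:R / eta) = eta / 2%:R by field; rewrite gt_eqF.
lra.
Qed.

End Bounded.

Lemma f_negligible (eps : R) : 0 < eps ->
  exists N : nat, forall n, (N <= n)%N -> (f n)%:R <= eps * (c n)%:R.
Proof.
(* Three points x, x + e, y = x + 2 e are used: partial sums of [c] stay below 1 at x, the lower
   bound for [c] holds at x + e, the upper bound for [f] at y. Hence 4224 = 2 * 2112, and the decay
   rate is (x + e) / y. *)
move=> eps0; pose e : R := (8%:R^-1 ^+ m) ^+ 2 / 4224%:R.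
have eta0 : 0 < 8%:R^-1 ^+ m :> R by rewrite exprn_gt0 //; lra.
have eta1 : 8%:R^-1 ^+ m <= 1 :> R by rewrite exprn_ile1 //; lra.
have e0 : 0 < e by rewrite divr_gt0 // exprn_gt0.
have e1 : e <= 160%:R^-1.
  have : (8%:R^-1 ^+ m) ^+ 2 <= 1 :> R by rewrite exprn_ile1 // ltW.
  by rewrite /e; set u := _ ^+ 2; lra.
have e2 : e + e <= (8%:R^-1 ^+ m) ^+ 2 / 2112%:R by rewrite /e; set u := _ ^+ 2; lra.
move: e e0 e1 e2 => e e0 e1 e2.
have [x /andP[x0 x1] [cx [M cM]]] := critical_grid e0.
have [y yE] : exists y, y = x + e + e by exists (x + e + e).
have fy N : psum f N y <= 1.
  apply: (@psum_f_bounded x) => //; rewrite yE; try lra.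
    have : e * e <= 160%:R^-1 * 160%:R^-1 by apply: ler_pM => //; exact: ltW.
    have : x * x <= x * (3%:R / 5%:R) by apply: ler_wpM2l; lra.
    have : x * e <= x * 160%:R^-1 by apply: ler_wpM2l; lra.
    by rewrite !expr2; lra.
have xe : 0 < x + e < 1 by lra.
have [d d0 cd] := c_lower xe cM.
have y0 : 0 < y by lra.
have w01 : 0 < (x + e) / y < 1.
  rewrite divr_gt0 //=; last by lra.
  by rewrite ltr_pdivrMr //; lra.
have [N NP] := geometric_decay w01 (mulr_gt0 eps0 d0).
exists N.+1 => n Nn; have n0 : (0 < n)%N := leq_ltn_trans (leq0n N) Nn.
have yn : 0 < y ^+ n by rewrite exprn_gt0.
have fn : (f n)%:R * y ^+ n <= 1.
  by apply: le_trans (fy n); apply: psum_term; rewrite ?n0 ?leqnn // ltW.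
have := NP n (ltnW Nn); rewrite expr_div_n mulrA ltr_pdivrMr // => h.
have cn := cd n n0.
have n0' : 0 < n%:R :> R by rewrite ltr0n.
have xn : 0 < (x + e) ^+ n by rewrite exprn_gt0 //; lra.
have k1 : n%:R * (x + e) ^+ n * (f n)%:R <= eps * d.
  have h1 : n%:R * (x + e) ^+ n * (f n)%:R <= eps * d * y ^+ n * (f n)%:R.
    by apply: ler_wpM2r => //; exact: ltW.
  apply: le_trans h1 _; rewrite -mulrA [y ^+ n * _]mulrC ler_piMr //.
  by rewrite mulr_ge0 // ltW.
have k2 : eps * d <= eps * (n%:R * (c n)%:R * (x + e) ^+ n).
  by apply: ler_wpM2l => //; exact: ltW.
have nx : 0 < n%:R * (x + e) ^+ n by rewrite mulr_gt0.
rewrite -(ler_pM2l nx); apply: le_trans k1 (le_trans k2 _).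
by rewrite le_eqVlt; apply/orP; left; apply/eqP; ring.
Qed.

End Comparison.

End Analysis.

(** * Counting cotrees *)

Unset Elimination Schemes.
Inductive cotree := Leaf | Node of seq cotree.
Set Elimination Schemes.

Definition cotree_ind (K : cotree -> Prop) (K_leaf : K Leaf)
    (K_node : forall s, foldr (fun t => and (K t)) True s -> K (Node s)) :=
  fix loop t : K t := match t with
  | Leaf => K_leaf
  | Node s0 =>
    let fix all_loop s : foldr (fun t => and (K t)) True s :=
      if s is u :: s' then conj (loop u) (all_loop s') else Logic.I
    in K_node s0 (all_loop s0)
  end.

Fixpoint gentree_of_cotree t : GenTree.tree unit :=
  match t with
  | Leaf => GenTree.Leaf tt
  | Node s => GenTree.Node 0 (map gentree_of_cotree s)
  end.

Fixpoint cotree_of_gentree (g : GenTree.tree unit) : cotree :=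
  match g with
  | GenTree.Leaf _ => Leaf
  | GenTree.Node _ s => Node (map cotree_of_gentree s)
  end.

Lemma gentree_of_cotreeK : cancel gentree_of_cotree cotree_of_gentree.
Proof.
elim=> //= s IHs; congr Node.
by elim: s IHs => //= t s IHs [-> /IHs ->].
Qed.

HB.instance Definition _ := Countable.copy cotree (can_type gentree_of_cotreeK).

Lemma cotree_in_ind (K : cotree -> Prop) :
  K Leaf -> (forall s, {in s, forall t, K t} -> K (Node s)) -> forall t, K t.
Proof.
move=> KL KN; elim=> // s IHs; apply: KN.
elim: s IHs => //= u s IHs [Ku /IHs Ks] t.
by rewrite inE => /predU1P[->|/Ks].
Qed.

Fixpoint leaves t : nat :=
  match t with Leaf => 1 | Node s => sumn (map leaves s) end.

Definition fleaves (s : seq cotree) : nat := sumn (map leaves s).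

(* Opaque, so that conversion never evaluates the codes of concrete trees. *)
Fact cotree_order :
  {r : rel cotree | [/\ total r, transitive r & antisymmetric r]}.
Proof.
exists (fun t u => pickle t <= pickle u); split.
- by move=> t u; apply: leq_total.
- by move=> t u v; apply: leq_trans.
- by move=> t u; rewrite -eqn_leq => /eqP /(pcan_inj pickleK).
Qed.

Definition cotree_le : rel cotree := sval cotree_order.

Lemma cotree_le_total : total cotree_le.
Proof. by case: (svalP cotree_order). Qed.

Lemma cotree_le_trans : transitive cotree_le.
Proof. by case: (svalP cotree_order). Qed.

Lemma cotree_le_anti : antisymmetric cotree_le.
Proof. by case: (svalP cotree_order). Qed.

Lemma cotree_le_refl : reflexive cotree_le.
Proof. by move=> t; have := cotree_le_total t t; rewrite orbb. Qed.

(* Sorting the children by an arbitrary total order selects one representative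
   of each unordered tree. *)
Fixpoint canonical t : bool :=
  match t with
  | Leaf => true
  | Node s => [&& 1 < size s, sorted cotree_le s & all canonical s]
  end.

Fixpoint has_limb tau t : bool :=
  (t == tau) || match t with Leaf => false | Node s => has (has_limb tau) s end.

Definition avoids tau t : bool := canonical t && ~~ has_limb tau t.

Lemma fleaves_cons t s : fleaves (t :: s) = leaves t + fleaves s.
Proof. by []. Qed.

Lemma fleaves_perm s1 s2 : perm_eq s1 s2 -> fleaves s1 = fleaves s2.
Proof. by move=> h; rewrite /fleaves; apply/perm_sumn/perm_map. Qed.

Lemma leaves_gt0 t : canonical t -> 0 < leaves t.
Proof.
elim/cotree_in_ind: t => // -[|t s] //= IH /and3P[_ _ /andP[ct _]].
by rewrite addn_gt0 IH ?mem_head.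
Qed.

Lemma size_fleaves s : all canonical s -> size s <= fleaves s.
Proof.
elim: s => //= t s IH /andP[/leaves_gt0 ct /IH]; rewrite fleaves_cons; lia.
Qed.

Lemma leaves_le_fleaves t s : t \in s -> leaves t <= fleaves s.
Proof.
elim: s => // u s IH; rewrite inE fleaves_cons => /predU1P[->|/IH]; lia.
Qed.

Lemma leaves_lt_node t s : canonical (Node s) -> t \in s -> leaves t < leaves (Node s).
Proof.
move=> /and3P[s1 _ cs] ts; rewrite -[leaves (Node s)]/(fleaves s).
have /fleaves_perm -> := perm_to_rem ts; rewrite fleaves_cons -addn1 leq_add2l.
apply: leq_trans (size_fleaves _); first by rewrite size_rem //; case: size s1 => [|[]].
by apply/allP => u /mem_rem; apply: (allP cs).
Qed.

Lemma canonical_eq_leaf t : canonical t -> leaves t = 1 -> t = Leaf.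
Proof.
case: t => // s /and3P[s1 _ /size_fleaves]; rewrite /fleaves /=; lia.
Qed.

Fixpoint words (T : Type) (L : seq T) k : seq (seq T) :=
  if k is k'.+1 then [::] :: allpairs cons L (words L k') else [:: [::]].

Lemma mem_words (T : eqType) (L : seq T) k s :
  {subset s <= L} -> size s <= k -> s \in words L k.
Proof.
elim: k s => [|k IH] [|x s] //= sL sk; rewrite inE /=.
apply/allpairsP; exists (x, s) => /=; split=> //.
  by apply: sL; rewrite mem_head.
by apply: IH => // y ys; apply: sL; rewrite inE ys orbT.
Qed.

(** A finite superset from which the counted trees are filtered: a canonical tree with at most n
    leaves has at most n children, each with fewer leaves than the tree. *)
Fixpoint trees_upto n : seq cotree :=
  if n is n'.+1 then Leaf :: map Node (words (trees_upto n') n) else [::].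

Lemma mem_trees_upto n t : canonical t -> leaves t <= n -> t \in trees_upto n.
Proof.
elim: n t => [|n IH] [|s] ct tn //.
- by have := leaves_gt0 ct; rewrite ltnNge tn.
- rewrite -[trees_upto n.+1]/(Leaf :: map Node (words (trees_upto n) n.+1)) inE.
  rewrite map_f ?orbT //; apply: mem_words.
    move=> t ts; apply: IH; first by case/and3P: ct => _ _ /allP; apply.
    by rewrite -ltnS; apply: leq_trans tn; apply: leaves_lt_node.
  by apply: leq_trans tn; case/and3P: ct => _ _ /size_fleaves.
Qed.

Lemma leq_size_in (T U : eqType) (f : T -> U) (A : seq T) (B : seq U) :
  uniq A -> {in A &, injective f} -> {in A, forall x, f x \in B} ->
  size A <= size B.
Proof.
move=> uA fI fB; rewrite -(size_map f); apply: uniq_leq_size.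
  by rewrite map_inj_in_uniq.
by move=> _ /mapP[x xA ->]; apply: fB.
Qed.

Lemma count_sumE (T : eqType) (L s : seq T) (w : T -> nat) :
  uniq L -> {subset s <= L} ->
  sumn (map w s) = \sum_(t <- L) w t * count_mem t s.
Proof.
move=> uL; elim: s => [|a s IH] sL /=.
  by rewrite big1_seq // => t _; rewrite muln0.
rewrite IH; last by move=> x xs; apply: sL; rewrite inE xs orbT.
under [RHS]eq_bigr do rewrite mulnDr.
rewrite big_split /=; congr (_ + _).
rewrite (bigD1_seq a) ?sL ?mem_head //= eqxx muln1.
by rewrite big1_seq ?addn0 // => t /andP[ta _]; rewrite eq_sym (negPf ta) muln0.
Qed.

Lemma sorted_sort_cons_rem t s :
  sorted cotree_le s -> t \in s -> sort cotree_le (t :: rem t s) = s.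
Proof.
move=> ss ts; apply: (sorted_eq cotree_le_trans cotree_le_anti) => //.
  exact: sort_sorted cotree_le_total _.
by rewrite perm_sort perm_sym; apply: perm_to_rem.
Qed.

Lemma sorted_rem_sort_cons t s :
  sorted cotree_le s -> rem t (sort cotree_le (t :: s)) = s.
Proof.
move=> ss; apply: (sorted_eq cotree_le_trans cotree_le_anti) => //.
  apply: (subseq_sorted cotree_le_trans) (rem_subseq _ _) _.
  exact: sort_sorted cotree_le_total _.
have /perm_to_rem : t \in sort cotree_le (t :: s) by rewrite mem_sort mem_head.
by move=> h; rewrite -(perm_cons t) -(permPl h) perm_sort.
Qed.

Section Counting.

Variable p : pred cotree.
Hypothesis p_canonical : forall t, p t -> canonical t.

Definition is_forest n s := [&& sorted cotree_le s, all p s & fleaves s == n].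

Definition forests n : seq (seq cotree) :=
  [seq s <- undup (words (trees_upto n) n) | is_forest n s].

Definition trees n : seq cotree :=
  [seq t <- undup (trees_upto n) | p t && (leaves t == n)].

Lemma all_p_canonical s : all p s -> all canonical s.
Proof. exact/sub_all/p_canonical. Qed.

Lemma mem_forests n s : (s \in forests n) = is_forest n s.
Proof.
rewrite mem_filter mem_undup; apply/andb_idr => /and3P[_ ps /eqP sn].
apply: mem_words; last by rewrite -sn; apply/size_fleaves/all_p_canonical.
move=> t ts; apply: mem_trees_upto; first exact: p_canonical (allP ps _ ts).
by rewrite -sn leaves_le_fleaves.
Qed.

Lemma mem_trees n t : (t \in trees n) = p t && (leaves t == n).
Proof.
rewrite mem_filter mem_undup; apply/andb_idr => /andP[pt /eqP tn].
by apply: mem_trees_upto; rewrite ?p_canonical ?tn.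
Qed.

Lemma uniq_forests n : uniq (forests n).
Proof. exact/filter_uniq/undup_uniq. Qed.

Lemma uniq_trees n : uniq (trees n).
Proof. exact/filter_uniq/undup_uniq. Qed.

Lemma size_forests0 : size (forests 0) = 1.
Proof.
apply: anti_leq; apply/andP; split; last first.
  by case: (forests 0) (mem_forests 0 [::]).
rewrite -[1]/(size [:: [::] : seq cotree]); apply: uniq_leq_size (uniq_forests _) _.
move=> s; rewrite mem_forests => /and3P[_ /all_p_canonical /size_fleaves + /eqP s0].
by rewrite s0; case: s {s0}.
Qed.

(** Removing one copy of [t] and inserting one in sorted position are mutually inverse and shift the
    multiplicity of [t] by one. *)
Lemma count_forests_mem n t i : p t ->
  count (fun s => i < count_mem t s) (forests n) =
  if leaves t <= n then count (fun s => i <= count_mem t s) (forests (n - leaves t))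
  else 0.
Proof.
move=> pt; have t0 := leaves_gt0 (p_canonical pt).
have [tn|nt] := leqP (leaves t) n; last first.
  apply/eqP; rewrite -leqn0 leqNgt -has_count; apply/hasPn => s.
  rewrite mem_forests => /and3P[_ _ /eqP sn].
  by have /count_memPn -> : t \notin s by apply/negP => /leaves_le_fleaves; lia.
rewrite -!size_filter; apply: anti_leq; apply/andP; split.
- apply: (leq_size_in (f := rem t)); first exact/filter_uniq/uniq_forests.
  + move=> s1 s2; rewrite !(mem_forests, mem_filter).
    move=> /andP[i1 /and3P[s1s _ _]] /andP[i2 /and3P[s2s _ _]] e.
    have t1 : t \in s1 by rewrite -has_pred1 has_count; lia.
    have t2 : t \in s2 by rewrite -has_pred1 has_count; lia.
    by rewrite -(sorted_sort_cons_rem s1s t1) e sorted_sort_cons_rem.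
  + move=> s; rewrite !(mem_forests, mem_filter) => /andP[i1 /and3P[ss ps /eqP sn]].
    have ts : t \in s by rewrite -has_pred1 has_count; lia.
    have hp := perm_to_rem ts; apply/and4P; split.
    * by rewrite count_rem ts /= eqxx subn1 -ltnS (ltn_predK i1) i1.
    * apply: (subseq_sorted cotree_le_trans) (rem_subseq _ _) ss.
    * by apply/allP => u /mem_rem; apply: (allP ps).
    * by have := fleaves_perm hp; rewrite fleaves_cons; lia.
- apply: (leq_size_in (f := fun s => sort cotree_le (t :: s))).
  + exact/filter_uniq/uniq_forests.
  + move=> s1 s2; rewrite !(mem_forests, mem_filter).
    move=> /andP[_ /and3P[s1s _ _]] /andP[_ /and3P[s2s _ _]] e.
    by rewrite -(sorted_rem_sort_cons t s1s) e sorted_rem_sort_cons.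
  + move=> s; rewrite !(mem_forests, mem_filter) => /andP[i1 /and3P[ss ps /eqP sn]].
    apply/and4P; split.
    * by rewrite count_sort /= eqxx add1n ltnS.
    * exact: sort_sorted cotree_le_total _.
    * by rewrite all_sort /= pt.
    * rewrite (fleaves_perm (s2 := t :: s)) ?perm_sort // fleaves_cons; lia.
Qed.

Lemma count_forests_mult n t i : p t ->
  count (fun s => i <= count_mem t s) (forests n) =
  if i * leaves t <= n then size (forests (n - i * leaves t)) else 0.
Proof.
move=> pt; elim: i n => [|i IH] n.
  by rewrite mul0n leq0n subn0 (eq_count (a2 := predT)) ?count_predT.
rewrite (count_forests_mem _ _ pt) IH mulSn.
case: leqP => tn; last by case: leqP => //; lia.
by rewrite leq_subRL // -subnDA.
Qed.

(* Double counting of the pairs (forest, leaf), grouped by the tree containing the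
   leaf and the rank of that tree among its copies. *)
Lemma forests_euler n :
  n * size (forests n) =
  \sum_(1 <= d < n.+1) \sum_(1 <= i < n.+1 | i * d <= n)
     d * size (trees d) * size (forests (n - i * d)).
Proof.
pose L := [seq t <- undup (trees_upto n) | p t && (0 < leaves t < n.+1)].
have uL : uniq L by apply/filter_uniq/undup_uniq.
have LP t : (t \in L) = p t && (leaves t <= n).
  rewrite mem_filter mem_undup ltnS; apply/idP/idP => [/andP[/and3P[-> _ ->]]|] //.
  move=> /andP[pt tn]; rewrite pt tn (leaves_gt0 (p_canonical pt)).
  by apply: mem_trees_upto => //; apply: p_canonical.
have -> : n * size (forests n) =
    \sum_(s <- forests n) \sum_(t <- L) leaves t * count_mem t s.
  rewrite -sum1_size big_distrr /=; apply: eq_big_seq => s.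
  rewrite mem_forests => /and3P[_ ps /eqP sn]; rewrite muln1 -{1}sn.
  apply: count_sumE => // t ts; rewrite LP (allP ps) //.
  by rewrite -sn leaves_le_fleaves.
rewrite exchange_big /=.
transitivity (\sum_(t <- L) \sum_(1 <= i < n.+1 | i * leaves t <= n)
   leaves t * size (forests (n - i * leaves t))).
  apply: eq_big_seq => t; rewrite LP => /andP[pt tn].
  rewrite -big_distrr -big_distrr /=; congr (_ * _).
  rewrite [RHS]big_mkcond /=.
  transitivity (\sum_(s <- forests n) \sum_(1 <= i < n.+1) (i <= count_mem t s : nat)).
    apply: eq_big_seq => s; rewrite mem_forests => /and3P[_ ps /eqP sn].
    have cn : count_mem t s <= n.
      by rewrite -sn; apply: leq_trans (count_size _ _) (size_fleaves (all_p_canonical ps)).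
    rewrite (@big_cat_nat _ _ _ (count_mem t s).+1) //=.
    rewrite [X in _ = _ + X](_ : _ = 0) ?addn0; last first.
      rewrite big_nat_cond big1 // => i /andP[/andP[h _] _].
      by rewrite leqNgt h.
    rewrite (eq_big_nat _ _ (F2 := fun=> 1)); first by rewrite sum_nat_const_nat subn1 muln1.
    by move=> i /andP[_ h]; rewrite -ltnS h.
  rewrite exchange_big /=; apply: eq_bigr => i _.
  rewrite -(count_forests_mult n i pt) -sum1_count [RHS]big_mkcond /=.
  by apply: eq_bigr => s _; case: leqP.
pose G d := \sum_(1 <= i < n.+1 | i * d <= n) d * size (forests (n - i * d)).
transitivity (\sum_(t <- L) \sum_(1 <= d < n.+1 | d == leaves t) G d).
  apply: eq_big_seq => t; rewrite LP => /andP[pt tn].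
  rewrite [RHS]big_mkcond [RHS](bigD1_seq (leaves t)) ?iota_uniq //=; last first.
    by rewrite mem_index_iota ltnS tn leaves_gt0 // p_canonical.
  by rewrite eqxx [X in _ = _ + X]big1 ?addn0 // => d /negPf ->.
rewrite (exchange_big_dep xpredT) //=; apply: eq_big_nat => d /andP[d1 dn].
rewrite -big_filter big_const_seq count_predT iter_addn_0.
have -> : size [seq t <- L | d == leaves t] = size (trees d).
  apply/perm_size/uniq_perm; [exact: filter_uniq|exact: uniq_trees|].
  by move=> t; rewrite mem_filter LP mem_trees eq_sym; case: eqP => [->|]; lia.
by rewrite /G big_distrl /=; apply: eq_bigr => i _; rewrite mulnAC.
Qed.

Lemma size_trees1 : size (trees 1) <= 1.
Proof.
apply: (@uniq_leq_size _ _ [:: Leaf]) (uniq_trees _) _ => t.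
by rewrite mem_trees inE => /andP[/p_canonical ct /eqP /(canonical_eq_leaf ct) ->].
Qed.

(** A tree yields the forest consisting of itself and, unless it is a leaf, the forest of its
    children; the first has size 1, the second does not. The leaf yields one forest only, whence the
    correction at n = 1. *)
Lemma trees_le_forests n : 0 < n ->
  (forall s, p (Node s) -> all p s) ->
  2 * size (trees n) <= size (forests n) + (n == 1).
Proof.
move=> n0 pN; rewrite -(count_predC (fun s => size s == 1) (forests n)) -!size_filter.
have h1 : size (trees n) <= size [seq s <- forests n | size s == 1].
  apply: (leq_size_in (f := fun t => [:: t])) (uniq_trees n) _ _; first by move=> t u _ _ [].
  move=> t; rewrite mem_trees !(mem_forests, mem_filter) /is_forest /= => /andP[-> /eqP tn].
  by rewrite /fleaves /= addn0 tn eqxx.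
have [n1|n1] := eqVneq n 1.
  rewrite mul2n -addnn leq_add //; first by apply: leq_trans h1 (leq_addr _ _).
  by rewrite n1 size_trees1.
rewrite addn0 mul2n -addnn leq_add //.
apply: (leq_size_in (f := fun t => if t is Node s then s else [::])) (uniq_trees n) _ _.
  move=> [|s] [|u]; rewrite !mem_trees /= ?(eq_sym 1) ?(negPf n1) ?andbF //.
  by move=> _ _ ->.
move=> [|s]; rewrite mem_trees !(mem_forests, mem_filter) /= ?(eq_sym 1) ?(negPf n1) ?andbF //.
move=> /andP[ps /eqP sn]; have /and3P[s1 ss _] := p_canonical ps.
by rewrite /is_forest ss pN // /fleaves sn eqxx gtn_eqF.
Qed.

End Counting.

(** A forest of one tree is sent to that tree, any larger one to the tree obtained by adding a
    root. *)
Lemma forests_le_trees n : 0 < n ->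
  size (forests canonical n) <= 2 * size (trees canonical n).
Proof.
move=> n0; rewrite -(count_predC (fun s => size s == 1) (forests canonical n)) -!size_filter.
have pc t : canonical t -> canonical t by [].
rewrite mul2n -addnn leq_add //.
- apply: (leq_size_in (f := head Leaf)); first exact/filter_uniq/uniq_forests.
    by move=> [|t[|? ?]] [|u[|? ?]]; rewrite !mem_filter //= => _ _ ->.
  move=> [|t[|? ?]]; rewrite (mem_trees pc) !(mem_forests pc, mem_filter) //=.
  by rewrite /is_forest /= andbT /fleaves /= addn0.
- apply: (leq_size_in (f := Node)); first exact/filter_uniq/uniq_forests.
    by move=> s u _ _ [].
  move=> s; rewrite (mem_trees pc) !(mem_forests pc, mem_filter) /= => /andP[s1 /and3P[-> -> /eqP sn]].
  rewrite -sn eqxx !andbT; case: s s1 sn => [|? []] //=; rewrite /fleaves /=; lia.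
Qed.

(** The first child is split off. At least one further child remains, so its number of leaves is
    below n. *)
Lemma trees_le_convolution n : 1 < n ->
  size (trees canonical n) <=
  \sum_(1 <= j < n) size (trees canonical j) * size (forests canonical (n - j)).
Proof.
move=> n1; have pc t : canonical t -> canonical t by [].
pose B := flatten [seq [seq (t, s) | t <- trees canonical j, s <- forests canonical (n - j)]
                     | j <- index_iota 1 n].
have -> : \sum_(1 <= j < n) size (trees canonical j) * size (forests canonical (n - j)) = size B.
  rewrite size_flatten sumnE big_map big_map.
  by apply: eq_bigr => j _; rewrite size_allpairs.
apply: (leq_size_in (f := fun t => if t is Node (u :: s) then (u, s) else (Leaf, [::]))).
- exact: uniq_trees.
- have nt t : t \in trees canonical n -> exists u s, t = Node (u :: s).
    rewrite (mem_trees pc); case: t => [|[|u s]] /andP[] //=; last by exists u, s.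
    by rewrite eq_sym (gtn_eqF n1).
  by move=> t t' /nt[u [s ->]] /nt[u' [s' ->]] [-> ->].
- move=> t; rewrite (mem_trees pc) => /andP[].
  case: t => [|[|u s]] //=; first by rewrite eq_sym (gtn_eqF n1).
  move=> /and3P[s1 us /andP[cu cs]] /eqP tn.
  apply/flatten_mapP; exists (leaves u).
    have := size_fleaves cs; rewrite mem_index_iota leaves_gt0 //= /fleaves; lia.
  apply/allpairsP; exists (u, s); rewrite /= (mem_trees pc) (mem_forests pc) cu eqxx.
  rewrite /is_forest cs (path_sorted us) /fleaves -tn addKn eqxx; by split.
Qed.

(** Only the terms i = 1 of the Euler identity are kept, and trees are bounded below by half the
    forests. The extra term k = n is n times the number of forests, as there is one empty forest,
    and uses up one of the two copies on the right. *)
Lemma forests_convolution_le n :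
  \sum_(1 <= k < n) k * size (forests canonical k) * size (forests canonical (n - k)) <=
  n * size (forests canonical n).
Proof.
case: n => [|n]; first by rewrite big_geq.
have pc t : canonical t -> canonical t by [].
suff : \sum_(1 <= k < n.+2)
    k * size (forests canonical k) * size (forests canonical (n.+1 - k)) <=
    2 * (n.+1 * size (forests canonical n.+1)).
  by rewrite big_nat_recr //= subnn size_forests0 // muln1; lia.
rewrite [in leqRHS]forests_euler // big_distrr /= big_nat_cond [leqRHS]big_nat_cond.
apply: leq_sum => d /andP[/andP[d1 dn] _].
rewrite ltnS in dn.
rewrite big_mkcond big_ltn //= mul1n dn.
have := forests_le_trees d1; set x := size _; set y := size _; set z := size _.
move=> xy; apply: (@leq_trans (2 * (d * y * z))); last by rewrite leq_mul2l leq_addr.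
apply: leq_trans (leq_mul (leq_mul (leqnn d) xy) (leqnn z)) _.
by rewrite mulnCA -!mulnA leqnn.
Qed.

Lemma sorted_nseq n t : sorted cotree_le (nseq n t).
Proof. by elim: n => //= -[|n] //= ->; rewrite cotree_le_refl. Qed.

Lemma canonical_refl t : canonical t -> canonical t. Proof. by []. Qed.

Lemma forests_gt0 n : 0 < size (forests canonical n).
Proof.
suff : nseq n Leaf \in forests canonical n by case: (forests _ _).
rewrite (mem_forests canonical_refl) /is_forest; apply/and3P; split.
- exact: sorted_nseq.
- by rewrite all_nseq orbT.
- by rewrite /fleaves map_nseq sumn_nseq mul1n.
Qed.

Lemma avoids_canonical tau t : avoids tau t -> canonical t.
Proof. by case/andP. Qed.

Lemma avoids_node tau s : avoids tau (Node s) -> all (avoids tau) s.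
Proof.
move=> /andP[/and3P[_ _ cs]] /=; rewrite negb_or -all_predC => /andP[_ hs].
apply/allP => t ts; apply/andP; split; [exact: (allP cs)|exact: (allP hs)].
Qed.

Lemma forests_avoids_le tau n :
  size (forests (avoids tau) n) <= size (forests canonical n).
Proof.
apply: uniq_leq_size; first exact: uniq_forests.
move=> s; rewrite (mem_forests (@avoids_canonical tau)) (mem_forests canonical_refl).
by move=> /and3P[ss ps sn]; apply/and3P; split=> //; apply: sub_all ps => t /andP[].
Qed.

(** The forest [[:: tau]] is counted on the right only. *)
Lemma forests_avoids_lt tau : canonical tau ->
  size (forests (avoids tau) (leaves tau)) < size (forests canonical (leaves tau)).
Proof.
move=> ct; rewrite -[_.+1]/(size ([:: tau] :: forests (avoids tau) (leaves tau))).
apply: uniq_leq_size.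
  rewrite /= uniq_forests andbT (mem_forests (@avoids_canonical tau)).
  have ht : has_limb tau tau by case: (tau) => *; rewrite /= ?eqxx.
  by rewrite /is_forest /= /avoids ht andbF.
move=> s; rewrite inE => /predU1P[->|].
  by rewrite (mem_forests canonical_refl) /is_forest /= ct /fleaves /= addn0 eqxx.
rewrite (mem_forests (@avoids_canonical tau)) (mem_forests canonical_refl).
by move=> /and3P[ss ps sn]; apply/and3P; split=> //; apply: sub_all ps => t /andP[].
Qed.

(** * Cographs and cotrees *)

(** Arbitrary finite vertex types make disjoint unions sum types, without index arithmetic on
    ordinals. *)
Record fingraph := FinGraph { vertex :> finType; adjacent : rel vertex }.

Definition simple X := symmetric (@adjacent X) /\ irreflexive (@adjacent X).

Definition gisom X Y := exists2 f : vertex X -> vertex Y,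
  bijective f & forall x y, adjacent (f x) (f y) = adjacent x y.

Definition gpoint := @FinGraph unit (fun _ _ => false).

Definition gempty := @FinGraph void (fun _ _ => false).

Definition union_rel (X Y : fingraph) (u v : vertex X + vertex Y) : bool :=
  match u, v with
  | inl a, inl b => adjacent a b
  | inr a, inr b => adjacent a b
  | _, _ => false
  end.

Definition gunion X Y := @FinGraph (vertex X + vertex Y)%type (@union_rel X Y).

Definition gcompl X := @FinGraph (vertex X) (fun x y => (x != y) && ~~ adjacent x y).

Definition ginduced (X : fingraph) (A : {set X}) :=
  @FinGraph {x | x \in A} (fun u v => adjacent (val u) (val v)).

(** A node complements the union of its children, so one kind of node suffices: unions and joins
    alternate with the depth, and canonical trees give connected graphs. *)
Fixpoint gtree t : fingraph :=
  match t with
  | Leaf => gpoint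
  | Node s => gcompl (foldr (fun u => gunion (gtree u)) gempty s)
  end.

Definition gforest s : fingraph := foldr (fun u => gunion (gtree u)) gempty s.

Definition P4free (X : fingraph) : Prop :=
  ~ exists a b c d : vertex X,
      [/\ uniq [:: a; b; c; d],
          [&& adjacent a b, adjacent b c & adjacent c d] &
          [&& ~~ adjacent a c, ~~ adjacent b d & ~~ adjacent a d]].

Lemma gisom_refl X : gisom X X.
Proof. by exists id => //; exists id. Qed.

Lemma gisom_sym X Y : gisom X Y -> gisom Y X.
Proof.
move=> [f [g fK gK] fe]; exists g; first by exists f.
by move=> x y; rewrite -fe !gK.
Qed.

Lemma gisom_trans Y X Z : gisom X Y -> gisom Y Z -> gisom X Z.
Proof.
move=> [f fb fe] [g gb ge]; exists (g \o f); first exact: bij_comp.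
by move=> x y; rewrite /= ge fe.
Qed.

Lemma gisom_compl X Y : gisom X Y -> gisom (gcompl X) (gcompl Y).
Proof.
move=> [f fb fe]; exists f => // x y /=.
by rewrite fe (inj_eq (bij_inj fb)).
Qed.

Lemma gisom_complK X : simple X -> gisom (gcompl (gcompl X)) X.
Proof.
move=> [sX iX]; exists id; first by exists id.
by move=> x y /=; case: eqVneq => [->|] //=; rewrite ?iX ?negbK.
Qed.

Lemma gisom_union X X' Y Y' :
  gisom X X' -> gisom Y Y' -> gisom (gunion X Y) (gunion X' Y').
Proof.
move=> [f [f' fK f'K] fe] [g [g' gK g'K] ge].
exists (fun u => match u with inl a => inl (f a) | inr b => inr (g b) end).
  exists (fun u => match u with inl a => inl (f' a) | inr b => inr (g' b) end);
    by move=> [a|b]; rewrite ?fK ?gK ?f'K ?g'K.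
by move=> [a|a] [b|b] /=; rewrite ?fe ?ge.
Qed.

Lemma gisom_unionC X Y : gisom (gunion X Y) (gunion Y X).
Proof.
exists (fun u => match u with inl a => inr a | inr b => inl b end).
  by exists (fun u => match u with inl a => inr a | inr b => inl b end); case.
by move=> [a|a] [b|b].
Qed.

Lemma gisom_unionA X Y Z : gisom (gunion X (gunion Y Z)) (gunion (gunion X Y) Z).
Proof.
exists (fun u => match u with inl a => inl (inl a) | inr (inl b) => inl (inr b)
                 | inr (inr c) => inr c end).
  by exists (fun u => match u with inl (inl a) => inl a | inl (inr b) => inr (inl b)
                 | inr c => inr (inr c) end); [case=> [a|[b|c]]|case=> [[a|b]|c]].
by move=> [a|[a|a]] [b|[b|b]].
Qed.

Lemma gisom_union0 X : gisom (gunion gempty X) X.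
Proof.
exists (fun u => match u with inl a => of_void _ a | inr b => b end).
  by exists inr => // -[].
by move=> [[]|a] [[]|b].
Qed.

Lemma gforest1 t : gisom (gtree t) (gforest [:: t]).
Proof.
apply: gisom_sym; apply: gisom_trans (gisom_unionC _ _) _; exact: gisom_union0.
Qed.

Lemma gforest_cat s1 s2 :
  gisom (gforest (s1 ++ s2)) (gunion (gforest s1) (gforest s2)).
Proof.
elim: s1 => [|t s1 IH]; first exact/gisom_sym/gisom_union0.
apply: gisom_trans (gisom_unionA _ _ _).
exact: gisom_union (gisom_refl _) IH.
Qed.

Lemma gforest_perm s1 s2 : perm_eq s1 s2 -> gisom (gforest s1) (gforest s2).
Proof.
elim: s1 s2 => [|t s1 IH] s2 h.
  by move: h; rewrite perm_sym => /perm_nilP ->; apply: gisom_refl.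
have ts : t \in s2 by rewrite -(perm_mem h) mem_head.
case/splitPr: ts h => a b; rewrite perm_sym perm_catC /= perm_cons perm_catC perm_sym.
move=> /IH h; apply: gisom_trans (gisom_sym (gforest_cat a (t :: b))).
apply: gisom_trans (gisom_union (gisom_refl (gtree t)) (gisom_trans h (gforest_cat a b))) _.
apply: gisom_trans (gisom_unionA _ _ _) _.
apply: gisom_trans (gisom_union (gisom_unionC _ _) (gisom_refl _)) _.
exact: gisom_sym (gisom_unionA _ _ _).
Qed.

Lemma gforest_sort s : gisom (gforest (sort cotree_le s)) (gforest s).
Proof. by apply: gforest_perm; rewrite perm_sort. Qed.

Lemma gisom_card X Y : gisom X Y -> #|X| = #|Y|.
Proof. by move=> [f fb _]; apply: bij_eq_card fb. Qed.

Lemma card_gtree t : #|gtree t| = leaves t.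
Proof.
elim/cotree_in_ind: t => [|s IH]; first by rewrite card_unit.
rewrite /=; elim: s IH => [|t s IHs] IH /=; first by rewrite card_void.
rewrite card_sum IH ?mem_head // IHs // => u us.
by apply: IH; rewrite inE us orbT.
Qed.

Lemma card_gforest s : #|gforest s| = fleaves s.
Proof.
by elim: s => [|t s IH]; rewrite ?card_void //= card_sum IH card_gtree.
Qed.

Lemma simple_union X Y : simple X -> simple Y -> simple (gunion X Y).
Proof.
move=> [sX iX] [sY iY]; split; first by move=> [a|a] [b|b] //=; rewrite ?sX ?sY.
by move=> [a|a] /=; rewrite ?iX ?iY.
Qed.

Lemma simple_compl X : simple X -> simple (gcompl X).
Proof.
move=> [sX iX]; split; first by move=> x y /=; rewrite eq_sym sX.
by move=> x /=; rewrite eqxx.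
Qed.

Lemma simple_induced (X : fingraph) (A : {set X}) : simple X -> simple (ginduced A).
Proof. by move=> [sX iX]; split => [u v|u] /=; [apply: sX|apply: iX]. Qed.

Lemma simple_gtree t : simple (gtree t).
Proof.
elim/cotree_in_ind: t => [|s IH] //; apply: simple_compl.
elim: s IH => [|t s IHs] IH /=; first by split; case.
apply: simple_union; first by apply: IH; rewrite mem_head.
by apply: IHs => u us; apply: IH; rewrite inE us orbT.
Qed.

Lemma simple_gforest s : simple (gforest s).
Proof.
by elim: s => [|t s IH] /=; [split; case|apply: simple_union (simple_gtree t) IH].
Qed.

Lemma P4free_embed (X Y : fingraph) (f : X -> Y) : injective f ->
  (forall x y, adjacent (f x) (f y) = adjacent x y) -> P4free Y -> P4free X.
Proof.
move=> fI fe PY [a [b [c [d [u e n]]]]]; apply: PY.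
exists (f a), (f b), (f c), (f d); rewrite !fe; split=> //.
by rewrite (map_inj_uniq fI [:: a; b; c; d]).
Qed.

Lemma P4free_isom X Y : gisom X Y -> P4free Y -> P4free X.
Proof. by move=> [f /bij_inj fI fe]; apply: P4free_embed fI fe. Qed.

Lemma P4free_union X Y : P4free X -> P4free Y -> P4free (gunion X Y).
Proof.
move=> PX PY [[a|a] [[b|b] [[c|c] [[d|d] [u e n]]]]]; try by case/and3P: e.
- by apply: PX; exists a, b, c, d.
- by apply: PY; exists a, b, c, d.
Qed.

(* The complement of the path a b c d is the path b d a c. *)
Lemma P4free_compl X : simple X -> P4free X -> P4free (gcompl X).
Proof.
move=> [sX _] PX [a [b [c [d [u e n]]]]]; apply: PX; exists b, d, a, c.
move: u e n; rewrite /= !inE !negb_or !andbT.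
move=> /and3P[/and3P[ab ac ad] /andP[bc bd] cd].
rewrite ab ac ad bc bd cd /= !negbK => /and3P[e1 e2 e3] /and3P[f1 f2 f3].
split; first by rewrite (eq_sym b a) (eq_sym d a) (eq_sym d c) ab ad cd.
- by rewrite f2 sX f3 f1.
- by rewrite sX e1 sX e3 e2.
Qed.

Lemma P4free_gtree t : P4free (gtree t).
Proof.
elim/cotree_in_ind: t => [|s IH]; first by case=> a [b [c [d [_ /and3P[]]]]].
apply: P4free_compl; first exact: simple_gforest.
elim: s IH => [|t s IHs] IH /=; first by case=> -[].
apply: P4free_union; first by apply: IH; rewrite mem_head.
by apply: IHs => u us; apply: IH; rewrite inE us orbT.
Qed.

Lemma P4free_gforest s : P4free (gforest s).
Proof.
elim: s => [|t s IH] /=; first by case=> -[].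
by apply: P4free_union => //; apply: P4free_gtree.
Qed.

(** * A cograph or its complement is disconnected *)

Definition homogeneous_split (X : fingraph) (S : {set X}) (b : bool) (A : {set X}) :=
  [/\ A \subset S, A != set0, A != S &
      forall x y, x \in A -> y \in S :\: A -> adjacent x y = b].

(* [Z] is the component of [w] in [S :\ v]. If [v] has a neighbour in [Z], then
   [Z] contains an edge [p q] with [q], but not [p], adjacent to [v]; a
   neighbour [u] of [v] outside [Z] would yield the induced path u v q p. *)
Lemma split_add_vertex (X : fingraph) (S : {set X}) (v : X) (A : {set X}) :
  simple X -> P4free X -> v \in S -> homogeneous_split (S :\ v) false A ->
  exists b B, homogeneous_split S b B.
Proof.
move=> [sX iX] PX vS [AY A0 AnY AC]; set Y := S :\ v in AY AnY AC.
have YS y : y \in S -> y != v -> y \in Y by move=> *; rewrite !inE; apply/andP.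
have [/forallP full|] := boolP [forall y, (y \in Y) ==> adjacent v y].
  exists true, [set v]; split.
  - by rewrite sub1set.
  - by apply/set0Pn; exists v; rewrite inE.
  - have /set0Pn[a aA] := A0; apply/eqP => e.
    by have := subsetP AY a aA; rewrite /Y -e !inE; case: eqP.
  - move=> x y /set1P -> /setDP[yS]; rewrite inE => yv.
    by have /implyP := full y; apply; apply: YS.
rewrite negb_forall => /existsP[w]; rewrite negb_imply => /andP[wY vw].
pose closed (Z : {set X}) := [&& Z \subset Y, w \in Z &
  [forall x, forall y, (x \in Z) && (y \in Y :\: Z) ==> ~~ adjacent x y]].
have closedP Z : closed Z -> forall x y, x \in Z -> y \in Y -> y \notin Z ->
    adjacent x y = false.
  move=> /and3P[_ _ /forallP h] x y xZ yY yZ; apply/negbTE.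
  by have /forallP /(_ y) /implyP := h x; apply; rewrite xZ inE yZ.
have [C cC CnY] : exists2 C, closed C & C != Y.
  have [wA|wA] := boolP (w \in A).
    exists A => //; rewrite /closed AY wA; apply/forallP => x; apply/forallP => y.
    by apply/implyP => /andP[xA yA]; rewrite AC.
  exists (Y :\: A).
    rewrite /closed subsetDl in_setD wA wY; apply/forallP => x; apply/forallP => y.
    apply/implyP => /andP[xA]; rewrite setDDr setDv set0U inE => /andP[_ yA].
    by rewrite sX AC.
  apply/eqP => e; have /set0Pn[a aA] := A0.
  by have := subsetP AY a aA; rewrite -e inE aA.
have [Z /minsetP[cZ minZ] ZC] := minset_exists cC.
have ZY : Z \subset Y by case/and3P: cZ.
have wZ : w \in Z by case/and3P: cZ.
have ZnY : Z != Y.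
  apply: contra_neq CnY => e; apply/eqP; rewrite eqEsubset -{2}e ZC andbT.
  by case/and3P: cC.
have vY : v \notin Y by rewrite !inE eqxx.
pose N := [set y in Z | ~~ adjacent v y].
(* Minimality of [Z] plays the role of connectedness: if no edge left [N] inside [Y], then [N] would
   be all of [Z], and [Z] would be separated from [v] as well. *)
have [cN|ncN] := boolP (closed N).
  have NZ : N = Z by apply: minZ => //; apply/subsetP => y; rewrite inE => /andP[].
  exists false, Z; split.
  - exact: subset_trans ZY (subsetDl _ _).
  - by apply/set0Pn; exists w.
  - by apply: contraNneq vY => e; apply: (subsetP ZY); rewrite e.
  - move=> x y xZ /setDP[yS yZ]; have [->|yv] := eqVneq y v.
      by move: xZ; rewrite -NZ inE sX => /andP[_ /negbTE].
    by apply: (closedP _ cZ) => //; apply: YS.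
have [p [q [pN qY qN pq]]] : exists p q, [/\ p \in N, q \in Y, q \notin N & adjacent p q].
  move: ncN; rewrite /closed inE wZ vw (subset_trans _ ZY) /=; last first.
    by apply/subsetP => y; rewrite inE => /andP[].
  rewrite negb_forall => /existsP[p]; rewrite negb_forall => /existsP[q].
  rewrite negb_imply negbK => /andP[/andP[pN /setDP[qY qN]] pq].
  by exists p, q.
have [pZ vp] : p \in Z /\ ~~ adjacent v p by apply/andP; rewrite inE in pN.
have qZ : q \in Z by apply: contraTT pq => qZ; rewrite (closedP _ cZ).
have vq : adjacent v q by move: qN; rewrite inE qZ /= negbK.
exists false, (Y :\: Z); split.
- exact: subset_trans (subsetDl _ _) (subsetDl _ _).
- rewrite setD_eq0; apply: contra ZnY => YZ.
  by rewrite eqEsubset ZY.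
- by apply: contraNneq vY => e; move: vS; rewrite -e => /setDP[].
move=> u y /setDP[uY uZ] /setDP[yS].
have [-> _|yv] := eqVneq y v; last first.
  by rewrite inE (YS _ yS yv) andbT negbK => yZ; rewrite sX (closedP _ cZ).
apply/negbTE/negP => uv; apply: PX; exists u, v, q, p.
have vN x : x \in Y -> x != v by rewrite !inE => /andP[].
have uN x : x \in Z -> u != x by move=> xZ; apply: contraNneq uZ => ->.
have uq : ~~ adjacent u q by rewrite sX (closedP _ cZ).
have up : ~~ adjacent u p by rewrite sX (closedP _ cZ).
have qp : q != p by apply: contraTneq vq => ->.
split; last by rewrite uq vp up.
- rewrite /= !inE !negb_or vN // !uN // qp !(eq_sym v) !vN //.
  exact: (subsetP ZY).
- by rewrite uv vq sX pq.
Qed.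

Lemma homogeneous_split_compl (X : fingraph) (S : {set X}) b (A : {set X}) :
  @homogeneous_split (gcompl X) S b A -> @homogeneous_split X S (~~ b) A.
Proof.
move=> [AS A0 An h]; split=> // x y xA yA; have /= <- := h x y xA yA.
have -> : x != y by apply: contraTneq xA => ->; case/setDP: yA.
by rewrite negbK.
Qed.

(** Induction by deleting a vertex. A split of the rest with value [true] becomes one with value
    [false] in the complement, which is again free of induced paths, so [split_add_vertex] covers
    both cases. Working with subsets [S] keeps the ambient graph fixed. *)
Lemma P4free_split (X : fingraph) (S : {set X}) : simple X -> P4free X -> 1 < #|S| ->
  exists b A, homogeneous_split S b A.
Proof.
move=> sX PX; have [n] := ubnP #|S|; elim: n S => // n IH S Sn S1.
have /card_gt0P[v vS] : 0 < #|S| by exact: ltnW.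
have Sv := cardsD1 v S; rewrite vS in Sv.
have [S2|S2] := leqP #|S :\ v| 1.
  have /cards1P[w wE] : #|S :\ v| == 1 by apply/eqP; lia.
  have /setD1P[wv wS] : w \in S :\ v by rewrite wE inE.
  exists (adjacent v w), [set v]; split; first by rewrite sub1set.
  - by apply/set0Pn; exists v; rewrite inE.
  - by apply: contraNneq wv => e; move: wS; rewrite -e inE.
  - by move=> x y /set1P ->; rewrite wE => /set1P ->.
have [|[] [A hA]] := IH (S :\ v) _ S2; first by lia.
  have h : @homogeneous_split (gcompl X) (S :\ v) false A.
    case: hA => AS A0 An h; split=> // x y xA yA /=.
    by rewrite h // andbF.
  have [b [B hB]] := split_add_vertex (simple_compl sX) (P4free_compl sX PX) vS h.
  by exists (~~ b), B; apply: (@homogeneous_split_compl X S b B hB).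
exact: split_add_vertex sX PX vS hA.
Qed.

Lemma card_induced (X : fingraph) (A : {set X}) : #|ginduced A| = #|A|.
Proof. by rewrite card_sig; apply: eq_card => x; rewrite inE. Qed.

Lemma gisom_split (X : fingraph) (A : {set X}) : simple X ->
  (forall x y, x \in A -> y \notin A -> adjacent x y = false) ->
  gisom (gunion (ginduced A) (ginduced (~: A))) X.
Proof.
move=> [sX _] hA.
pose f (u : gunion (ginduced A) (ginduced (~: A))) : X :=
  match u with inl a => val a | inr b => val b end.
exists f; last first.
  move=> [[a aA]|[a aA]] [[b bA]|[b bA]] //=; rewrite inE in aA bA *.
  - by rewrite hA.
  - by rewrite sX hA.
have fI : injective f.
  move=> [[a aA]|[a aA]] [[b bA]|[b bA]] /= e.
  - by congr inl; apply: val_inj.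
  - by move: bA (bA); rewrite {1}inE -e aA.
  - by move: aA (aA); rewrite {1}inE e bA.
  - by congr inr; apply: val_inj.
apply: inj_card_bij fI _.
by rewrite [X in _ <= X]card_sum [X in _ <= X + _]card_induced
  [X in _ <= _ + X]card_induced cardsC.
Qed.

Theorem cotree_representation (X : fingraph) : simple X -> P4free X ->
  exists s, [/\ sorted cotree_le s, all canonical s & gisom X (gforest s)].
Proof.
have [n] := ubnP #|X|; elim: n X => // n IH X Xn sX PX.
(* Stated for an arbitrary graph of bounded size because it is applied to [X] and to its complement;
   in the latter case [1 < size s] makes [Node s] canonical. *)
have disc (Y : fingraph) (A : {set Y}) : simple Y -> P4free Y -> #|Y| <= n ->
    homogeneous_split setT false A ->
    exists s, [/\ sorted cotree_le s, all canonical s, 1 < size s & gisom Y (gforest s)].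
  move=> sY PY Yn [_ A0 AT hA].
  have ind (B : {set Y}) : B != setT -> exists s, [/\ sorted cotree_le s, all canonical s &
      gisom (ginduced B) (gforest s)].
    move=> BT; apply: IH.
    - have /proper_card : B \proper setT by rewrite properT.
      by rewrite cardsT card_induced => /leq_trans; apply.
    - exact: simple_induced.
    - exact: (@P4free_embed (ginduced B) Y val) val_inj _ PY.
  have nonempty (B : {set Y}) s : B != set0 -> gisom (ginduced B) (gforest s) -> 0 < size s.
    move=> /set0Pn[x xB] /gisom_card; rewrite card_gforest card_induced.
    by case: s => // /eqP; rewrite cards_eq0 => /eqP B0; rewrite B0 inE in xB.
  have AC0 : ~: A != set0 by rewrite -setCT (inj_eq (@setC_inj _)).
  have ACT : ~: A != setT by rewrite -setC0 (inj_eq (@setC_inj _)).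
  have [s1 [_ c1 i1]] := ind A AT.
  have [s2 [_ c2 i2]] := ind (~: A) ACT.
  exists (sort cotree_le (s1 ++ s2)); split.
  - exact: sort_sorted cotree_le_total _.
  - by rewrite all_sort all_cat c1.
  - have := nonempty _ _ A0 i1; have := nonempty _ _ AC0 i2.
    rewrite size_sort size_cat; lia.
  - have hAC x y : x \in A -> y \notin A -> adjacent x y = false.
      by move=> xA yA; apply: hA; rewrite // !inE yA.
    apply: gisom_trans (gisom_sym (gisom_split sY hAC)) _.
    apply: gisom_trans (gisom_union i1 i2) _.
    apply: gisom_trans (gisom_sym (gforest_cat _ _)) (gisom_sym (gforest_sort _)).
have [X1|X1] := leqP #|X| 1; last first.
  rewrite -cardsT in X1.
  have [[] [A hA]] := P4free_split sX PX X1; last first.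
    by have [s [ss cs _ i]] := disc X A sX PX Xn hA; exists s.
  have hA' : @homogeneous_split (gcompl X) setT false A.
    by case: hA => AS A0 An h; split=> // x y xA yA /=; rewrite h // andbF.
  have [s [ss cs s1 i]] :=
    disc (gcompl X) A (simple_compl sX) (P4free_compl sX PX) Xn hA'.
  exists [:: Node s]; split=> //; first by rewrite /= s1 ss cs.
  apply: gisom_trans (gforest1 _); apply: gisom_trans (gisom_sym (gisom_complK sX)) _.
  exact: gisom_compl.
have [/card0_eq X0|X0] := posnP #|X|.
  exists [::]; split=> //.
  have XF (x : X) : void by have := X0 x; rewrite inE.
  exists XF; last by move=> x; case: (XF x).
  by exists (of_void X) => x; [case: (XF x)|case: x].
have /fintype1P[x xE] : #|X| == 1 by rewrite eqn_leq X1 X0.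
exists [:: Leaf]; split=> //; apply: gisom_trans (gforest1 _).
exists (fun=> tt); last by move=> y z; rewrite (xE y) (xE z) (proj2 sX).
by exists (fun=> x) => [y|[]] //; rewrite (xE y).
Qed.

(** * Recovering the cotree from its graph *)

Definition gconnected (X : fingraph) := forall A : {set X},
  (forall x y, x \in A -> adjacent x y -> y \in A) -> A != set0 -> A = setT.

Lemma gconnected_compl_union (X Y : fingraph) : 0 < #|X| -> 0 < #|Y| ->
  gconnected (gcompl (gunion X Y)).
Proof.
move=> /card_gt0P[x0 _] /card_gt0P[y0 _] A Acl /set0Pn[a aA].
have crossl x y : inl x \in A -> inr y \in A by move=> h; apply: Acl h _.
have crossr x y : inr y \in A -> inl x \in A by move=> h; apply: Acl h _.
have xA : inl x0 \in A.
  by case: a aA => [x xA|y yA]; [apply: (crossr x0 y0 (crossl x y0 xA))|apply: (crossr x0 y)].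
have yA := crossl x0 y0 xA.
by apply/setP => -[x|y]; rewrite inE ?(crossl _ _ xA) ?(crossr _ _ yA).
Qed.

Lemma gconnected_gtree t : canonical t -> gconnected (gtree t).
Proof.
case: t => [_ A _ /set0Pn[[] uA]|[|t [|u s]] //].
  by apply/setP => -[]; rewrite uA inE.
move=> /and4P[_ _ ct /andP[cu _]]; apply: gconnected_compl_union.
  by rewrite card_gtree leaves_gt0.
by rewrite (card_gforest (u :: s)) fleaves_cons addn_gt0 leaves_gt0.
Qed.

(** For connected [G]: the vertex lies in a connected component isomorphic to [G], the image of [f]
    being closed under adjacency. Counting such vertices, instead of components, gives an
    isomorphism invariant additive over unions. *)
Definition is_component (G X : fingraph) (x : X) := exists f : G -> X,
  [/\ injective f, forall u v, adjacent (f u) (f v) = adjacent u v,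
      exists u, f u = x & forall u y, adjacent (f u) y -> exists v, f v = y].

Definition component_vertices (G X : fingraph) : nat :=
  #|[set x : X | `[< is_component G x >]]|.

Lemma is_component_isom G (X Y : fingraph) (h : X -> Y) x : bijective h ->
  (forall a b, adjacent (h a) (h b) = adjacent a b) ->
  is_component G x -> is_component G (h x).
Proof.
move=> hb he [f [fI fe [u ux] fcl]]; have [h' hK h'K] := hb.
exists (h \o f); split => [||  | v y] /=.
- exact: inj_comp (bij_inj hb) fI.
- by move=> v w; rewrite /= he fe.
- by exists u; rewrite /= ux.
- by rewrite -[y]h'K he => /fcl[w <-]; exists w.
Qed.

Lemma component_vertices_isom G X Y :
  gisom X Y -> component_vertices G X = component_vertices G Y.
Proof.
suff h U V : gisom U V -> component_vertices G U <= component_vertices G V.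
  by move=> XY; apply: anti_leq; rewrite (h _ _ XY) (h _ _ (gisom_sym XY)).
move=> [f fb fe]; rewrite /component_vertices -(card_imset _ (bij_inj fb)).
apply/subset_leq_card/subsetP => _ /imsetP[x + ->].
by rewrite !inE => /asboolP xc; apply/asboolP/is_component_isom.
Qed.

(** The vertices that [f] sends to the left summand form a set closed under adjacency, hence all of
    the connected graph [G]. The vertex [a] is a default value in [f']. *)
Lemma is_component_inl G (X Y : fingraph) (a : X) : gconnected G ->
  is_component G (inl a : gunion X Y) <-> is_component G a.
Proof.
move=> Gc; split=> [[f [fI fe [u0 fu0] fcl]]|[f [fI fe [u0 fu0] fcl]]]; last first.
  exists (fun u => inl (f u)); split=> //.
  - by move=> u v [/fI].
  - by exists u0; rewrite fu0.
  - by move=> u [y /fcl[v <-]|//]; exists v.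
pose f' u := if f u is inl z then z else a.
have AT : [set u | if f u is inl _ then true else false] = setT.
  apply: Gc; last by apply/set0Pn; exists u0; rewrite inE fu0.
  by move=> u v; rewrite !inE -fe; case: (f u) => // x; case: (f v).
have fE u : f u = inl (f' u).
  by have := in_setT u; rewrite -AT inE /f'; case: (f u).
exists f'; split.
- by move=> u v e; apply: fI; rewrite !fE e.
- by move=> u v; rewrite -fe !fE.
- by exists u0; rewrite /f' fu0.
- move=> u y uy; have [v] : exists v, f v = inl y by apply: (fcl u); rewrite fE.
  by rewrite fE => -[<-]; exists v.
Qed.

Lemma component_vertices_union G X Y : gconnected G ->
  component_vertices G (gunion X Y) = component_vertices G X + component_vertices G Y.
Proof.
move=> Gc; rewrite /component_vertices -!sum1dep_card big_sumType /=.
congr (_ + _); apply: eq_bigl => x; apply/asboolP/asboolP.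
- by move/is_component_inl; apply.
- by move/(is_component_inl Y _ Gc).
- pose h (u : gunion X Y) : gunion Y X := match u with inl a => inr a | inr b => inl b end.
  have hb : bijective h.
    by exists (fun u => match u with inl a => inr a | inr b => inl b end); case.
  have he u v : adjacent (h u) (h v) = adjacent u v by case: u; case: v.
  by move/(is_component_isom hb he)/is_component_inl; apply.
- pose h (u : gunion Y X) : gunion X Y := match u with inl a => inr a | inr b => inl b end.
  have hb : bijective h.
    by exists (fun u => match u with inl a => inr a | inr b => inl b end); case.
  have he u v : adjacent (h u) (h v) = adjacent u v by case: u; case: v.
  by move/(is_component_inl X _ Gc)/(is_component_isom hb he).
Qed.

Lemma component_vertices_empty G : component_vertices G gempty = 0.
Proof. by apply/eqP; rewrite cards_eq0; apply/eqP/setP => -[]. Qed.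

Lemma component_vertices_connected G X : gconnected X ->
  component_vertices G X = if `[< gisom G X >] then #|X| else 0.
Proof.
move=> Xc; case: asboolP => [[f [f' fK f'K] fe]|nGX].
  rewrite /component_vertices -cardsT; congr #|pred_of_set _|; apply/setP => x.
  rewrite !inE; apply/asboolP; exists f; split=> //; first exact: can_inj fK.
    by exists (f' x).
  by move=> u y _; exists (f' y).
apply/eqP; rewrite cards_eq0 -subset0; apply/subsetP => x; rewrite inE.
move=> /asboolP[f [fI fe [u0 fu0] fcl]]; case: nGX; exists f => //.
have fT : [set f u | u in G] = setT.
  apply: Xc; last by apply/set0Pn; exists x; rewrite -fu0 imset_f.
  by move=> _ y /imsetP[u _ ->] /fcl[v <-]; rewrite imset_f.
apply: inj_card_bij => //; rewrite -cardsT -fT; exact: leq_imset_card.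
Qed.

Lemma component_vertices_gforest tau s : canonical tau -> all canonical s ->
  {in s, forall t, gisom (gtree tau) (gtree t) -> tau = t} ->
  component_vertices (gtree tau) (gforest s) = leaves tau * count_mem tau s.
Proof.
move=> ctau; elim: s => [|t s IH] /= cs inj; first by rewrite component_vertices_empty muln0.
case/andP: cs => ct cs; rewrite component_vertices_union; last exact: gconnected_gtree.
rewrite IH //; last by move=> u us; apply: inj; rewrite inE us orbT.
rewrite mulnDr component_vertices_connected; last exact: gconnected_gtree.
congr (_ + _); case: asboolP => h.
  by rewrite (inj t) ?mem_head // eqxx muln1 card_gtree.
by case: eqP h => [->|_ _]; rewrite ?muln0 // => -[]; apply: gisom_refl.
Qed.

(** The component counts determine the multiplicity of each tree, and a sorted list is determined by
    its multiplicities. Injectivity on trees is assumed only for the members of the two lists, so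
    that the induction in [gtree_inj] can supply it. *)
Lemma gforest_inj_in s s' :
  sorted cotree_le s -> all canonical s -> sorted cotree_le s' -> all canonical s' ->
  {in s ++ s' &, forall t u, gisom (gtree t) (gtree u) -> t = u} ->
  gisom (gforest s) (gforest s') -> s = s'.
Proof.
move=> ss cs ss' cs' inj iso.
apply: (sorted_eq cotree_le_trans cotree_le_anti) => //.
apply/allP => t tss /=.
have ct : canonical t by move: tss; rewrite mem_cat => /orP[/(allP cs)|/(allP cs')].
have := component_vertices_isom (gtree t) iso.
rewrite !component_vertices_gforest //.
- by move/eqP; rewrite eqn_pmul2l // leaves_gt0.
- by move=> u us; apply: inj; rewrite // mem_cat us orbT.
- by move=> u us; apply: inj; rewrite // mem_cat us.
Qed.

(** Complementing both graphs strips the roots and leaves two forests of trees with fewer leaves. *)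
Theorem gtree_inj t u : canonical t -> canonical u -> gisom (gtree t) (gtree u) -> t = u.
Proof.
have [n] := ubnP (leaves t); elim: n t u => // n IH t u tn ct cu iso.
have tu : leaves t = leaves u by rewrite -!card_gtree; apply: gisom_card.
case: t u tn ct cu tu iso => [|s] [|s'] tn ct cu tu iso //.
- by apply/esym/canonical_eq_leaf.
- exact: canonical_eq_leaf.
have [_ ss cs] := and3P ct; have [_ ss' cs'] := and3P cu.
congr Node; apply: gforest_inj_in => //; last first.
  apply: gisom_trans (gisom_sym (gisom_complK (simple_gforest s))) _.
  apply: gisom_trans (gisom_complK (simple_gforest s')).
  exact: gisom_compl iso.
have h v : v \in s ++ s' -> canonical v /\ leaves v < n.
  rewrite mem_cat => /orP[vs|vs].
    by split; [exact: (allP cs)|apply: leq_trans (leaves_lt_node ct vs) _].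
  split; first exact: (allP cs').
  by apply: leq_trans (leaves_lt_node cu vs) _; rewrite -tu.
by move=> v w /h[cv vn] /h[cw _]; apply: IH.
Qed.

Theorem gforest_inj s s' :
  sorted cotree_le s -> all canonical s -> sorted cotree_le s' -> all canonical s' ->
  gisom (gforest s) (gforest s') -> s = s'.
Proof.
move=> ss cs ss' cs'; apply: gforest_inj_in => // t u.
rewrite !mem_cat => ts us; apply: gtree_inj.
  by case/orP: ts => [/(allP cs)|/(allP cs')].
by case/orP: us => [/(allP cs)|/(allP cs')].
Qed.

(** * Generalized cospectrality *)

Local Open Scope ring_scope.

Lemma det_relabel (R : comNzRingType) n (s : 'S_n) (A B : 'M[R]_n) :
  (forall i j, B i j = A (s i) (s j)) -> \det B = \det A.
Proof.
move=> BA; have -> : B = row_perm s (col_perm s A) by apply/matrixP => i j; rewrite !mxE.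
rewrite row_permE col_permE !det_mulmx !det_perm odd_permV mulrCA.
by rewrite -signr_addb addbb mulr1.
Qed.

(** The matrix determinant lemma, read off from two factorizations of one block matrix. *)
Lemma det_add1_mul (R : comNzRingType) n (a : 'cV[R]_n) (b : 'rV[R]_n) :
  \det (1%:M + a *m b) = 1 + (b *m a) 0 0.
Proof.
have h1 : block_mx 1%:M (- b) a 1%:M =
    block_mx 1%:M 0 a 1%:M *m block_mx 1%:M (- b) 0 (1%:M + a *m b) :> 'M_(1 + n).
  by rewrite mulmx_block !(mul1mx, mulmx1, mul0mx, mulmx0, addr0) mulmxN addrCA addNr addr0.
have h2 : block_mx 1%:M (- b) a 1%:M =
    block_mx (1%:M + b *m a) (- b) 0 1%:M *m block_mx 1%:M 0 a 1%:M :> 'M_(1 + n).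
  by rewrite mulmx_block !(mul1mx, mulmx1, mul0mx, mulmx0, add0r) mulNmx addrK.
have := congr1 determinant h1; rewrite h2 !det_mulmx !det_lblock !det_ublock !det1 !mul1r !mulr1.
by move=> <-; rewrite det_mx11 !mxE.
Qed.

(* Where the block matrix is invertible, the determinant lemma
   [\det (M + J) = \det M * (1 + 1^T M^-1 1)] reduces the claim to additivity of the
   sum of the entries of the inverse. *)
Lemma det_block_add_const_unit (F : fieldType) n1 n2 (A : 'M[F]_n1) (B : 'M[F]_n2) :
  \det A != 0 -> \det B != 0 ->
  \det (block_mx A 0 0 B + const_mx 1) =
  \det (A + const_mx 1) * \det B + \det A * \det (B + const_mx 1) - \det A * \det B.
Proof.
have key n (M : 'M[F]_n) : \det M != 0 -> \det (M + const_mx 1) =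
    \det M * (1 + ((const_mx 1 : 'rV_n) *m (invmx M *m (const_mx 1 : 'cV_n))) 0 0).
  move=> M0; have uM : M \in unitmx by rewrite unitmxE unitfE.
  have -> : M + const_mx 1 =
      M *m (1%:M + (invmx M *m (const_mx 1 : 'cV_n)) *m (const_mx 1 : 'rV_n)).
    rewrite mulmxDr mulmx1 !mulmxA mulmxV // mul1mx; congr (_ + _).
    by apply/matrixP => i j; rewrite !mxE big_ord1 !mxE mulr1.
  by rewrite det_mulmx det_add1_mul.
move=> A0 B0; have uA : A \in unitmx by rewrite unitmxE unitfE.
have uB : B \in unitmx by rewrite unitmxE unitfE.
have dAB : \det (block_mx A 0 0 B) = \det A * \det B by rewrite det_ublock.
have AB0 : \det (block_mx A 0 0 B) != 0 by rewrite dAB mulf_neq0.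
rewrite !key // dAB.
have uAB : block_mx A 0 0 B \in unitmx by rewrite unitmxE unitfE.
have -> : invmx (block_mx A 0 0 B) *m (const_mx 1 : 'cV_(n1 + n2)) =
    col_mx (invmx A *m const_mx 1) (invmx B *m const_mx 1).
  apply: (can_inj (mulKmx uAB)); rewrite mulKVmx // mul_block_col !mul0mx addr0 add0r.
  by rewrite !mulKVmx // col_mx_const.
rewrite -row_mx_const mul_row_col mxE; ring.
Qed.

(** Multiplying the difference by [r] removes the exceptional points; the product then vanishes at
    more natural numbers than its degree allows. *)
Lemma poly_ext_off_roots (F : numFieldType) (r p q : {poly F}) : r != 0 ->
  (forall z, r.[z] != 0 -> p.[z] = q.[z]) -> p = q.
Proof.
move=> r0 pq; apply/eqP; rewrite -subr_eq0; apply/eqP; apply: (mulIf r0); rewrite mul0r.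
set h := _ * r; pose rs := [seq i%:R : F | i <- iota 0 (size h)].
apply: (@roots_geq_poly_eq0 _ h rs).
- apply/allP => z _; rewrite /root /h hornerM hornerD hornerN.
  by have [->|/pq ->] := eqVneq r.[z] 0; rewrite ?mulr0 // subrr mul0r.
- rewrite map_inj_uniq ?iota_uniq //; exact: mulrIn (oner_neq0 _).
- by rewrite size_map size_iota.
Qed.

Lemma horner_char_poly (R : comNzRingType) n (A : 'M[R]_n) z :
  (char_poly A).[z] = \det (z%:M - A).
Proof.
rewrite /char_poly -horner_evalE -det_map_mx; congr (\det _).
apply/matrixP => i j; rewrite !mxE -[LHS]/(('X *+ (i == j) - (A i j)%:P).[z]).
by rewrite hornerD hornerN hornerMn hornerX hornerC.
Qed.

(** Both sides are polynomials in z, as z I - A + J is the characteristic matrix of A - J evaluated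
    at z. They agree off the roots of the characteristic polynomials of A and B, where the blocks
    are invertible. *)
Lemma det_block_add_const n1 n2 (A : 'M[algC]_n1) (B : 'M[algC]_n2) (z : algC) :
  \det (z%:M - block_mx A 0 0 B + const_mx 1) =
  \det (z%:M - A + const_mx 1) * \det (z%:M - B) +
  \det (z%:M - A) * \det (z%:M - B + const_mx 1) -
  \det (z%:M - A) * \det (z%:M - B).
Proof.
have e m (M : 'M[algC]_m) y :
    \det (y%:M - M + const_mx 1) = (char_poly (M - const_mx 1)).[y].
  by rewrite horner_char_poly opprB addrA addrAC.
have step y : \det (y%:M - A) != 0 -> \det (y%:M - B) != 0 ->
    \det (y%:M - block_mx A 0 0 B + const_mx 1) =
    \det (y%:M - A + const_mx 1) * \det (y%:M - B) +
    \det (y%:M - A) * \det (y%:M - B + const_mx 1) -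
    \det (y%:M - A) * \det (y%:M - B).
  move=> yA yB; rewrite -det_block_add_const_unit //.
  by rewrite scalar_mx_block opp_block_mx add_block_mx !oppr0 !addr0.
rewrite !e -!horner_char_poly -!hornerM -!hornerD -hornerN -hornerD.
congr _.[z]; apply: (@poly_ext_off_roots _ (char_poly A * char_poly B)).
  by rewrite mulf_neq0 // monic_neq0 // char_poly_monic.
move=> y; rewrite hornerM mulf_eq0 negb_or => /andP[yA yB].
have := step y; rewrite !e -!horner_char_poly => /(_ yA yB) ->.
by rewrite hornerD hornerN hornerD !hornerM.
Qed.

Definition adjmx (X : fingraph) n (f : 'I_n -> X) : 'M[algC]_n :=
  \matrix_(i, j) (adjacent (f i) (f j))%:R.

Definition charval (X : fingraph) (z : algC) : algC :=
  \det (z%:M - adjmx (@enum_val X predT)).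

(** The complement has adjacency matrix J - I - A, with J the all-ones matrix, so up to sign its
    characteristic polynomial at z is this value at -1 - z. *)
Definition charvalJ (X : fingraph) (z : algC) : algC :=
  \det (z%:M - adjmx (@enum_val X predT) + const_mx 1).

Lemma charvalE (X : fingraph) n (f : 'I_n -> X) z : bijective f ->
  charval X z = \det (z%:M - adjmx f) /\
  charvalJ X z = \det (z%:M - adjmx f + const_mx 1).
Proof.
move=> fb; have nX : n = #|X| by rewrite -(bij_eq_card fb) card_ord.
subst n; have sI : injective (enum_rank \o f).
  by apply: inj_comp; [exact: enum_rank_inj|exact: bij_inj].
by split; apply/esym/(det_relabel (s := perm sI)) => i j;
  rewrite !mxE !permE /= !enum_rankK (inj_eq sI).
Qed.

Lemma charval_isom X Y z : gisom X Y ->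
  charval X z = charval Y z /\ charvalJ X z = charvalJ Y z.
Proof.
move=> [f fb fe]; have gb : bijective (f \o @enum_val X predT).
  exact: bij_comp fb (@enum_val_bij X).
have [-> ->] := charvalE z gb.
have -> // : adjmx (f \o @enum_val X predT) = adjmx (@enum_val X predT).
by apply/matrixP => i j; rewrite !mxE fe.
Qed.

Lemma charval_union X Y z :
  charval (gunion X Y) z = charval X z * charval Y z /\
  charvalJ (gunion X Y) z = charvalJ X z * charval Y z + charval X z * charvalJ Y z
    - charval X z * charval Y z.
Proof.
pose f (k : 'I_(#|X| + #|Y|)) : gunion X Y :=
  match split k with inl i => inl (enum_val i) | inr j => inr (enum_val j) end.
have fb : bijective f.
  exists (fun u => match u with inl a => lshift _ (enum_rank a)
                           | inr b => rshift _ (enum_rank b) end).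
    by move=> k; rewrite /f -[RHS]splitK; case: (split k) => i; rewrite enum_valK.
  by move=> [a|b]; rewrite /f ?(unsplitK (inl _)) ?(unsplitK (inr _)) enum_rankK.
have [-> ->] := charvalE z fb.
have -> : adjmx f = block_mx (adjmx (@enum_val X predT)) 0 0 (adjmx (@enum_val Y predT)).
  apply/matrixP => i j; rewrite !mxE /f; case: (split i) => k; rewrite mxE;
  by case: (split j) => l; rewrite !mxE.
rewrite det_block_add_const; split=> //.
by rewrite scalar_mx_block opp_block_mx add_block_mx !oppr0 !addr0 det_ublock.
Qed.

Lemma charval_compl X z : simple X ->
  charval (gcompl X) z = (-1) ^+ #|X| * charvalJ X (-1 - z) /\
  charvalJ (gcompl X) z = (-1) ^+ #|X| * charval X (-1 - z).
Proof.
move=> [_ iX]; have [-> ->] := @charvalE (gcompl X) _ (@enum_val X predT) z (@enum_val_bij X).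
rewrite /charval /charvalJ -!detZ.
by split; congr (\det _); apply/matrixP => i j; rewrite !mxE /= (inj_eq enum_val_inj);
  case: eqVneq => [->|_]; rewrite /= ?iX ?mulr1n ?mulr0n;
  try ring; case: (adjacent _ _) => /=; ring.
Qed.

Lemma charval_point z : charval gpoint z = z /\ charvalJ gpoint z = z + 1.
Proof.
have fb : bijective (fun _ : 'I_1 => tt : gpoint).
  by exists (fun=> ord0); [move=> i; rewrite [RHS]ord1|case].
have [-> ->] := charvalE z fb.
by rewrite !det_mx11 !mxE /= mulr1n subr0.
Qed.

Lemma charval_empty z : charval gempty z = 1 /\ charvalJ gempty z = 1.
Proof.
have fb : bijective (fun i : 'I_0 => False_rect gempty (notF (ltn_ord i))).
  by exists (of_void _) => -[].
by have [-> ->] := charvalE z fb; rewrite !det_mx00.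
Qed.

(** This implies generalized cospectrality, in a form that the formulas for unions and complements
    visibly preserve. *)
Definition cospectral (X Y : fingraph) := #|X| = #|Y| /\
  forall z, charval X z = charval Y z /\ charvalJ X z = charvalJ Y z.

Lemma cospectral_refl X : cospectral X X. Proof. by []. Qed.

Lemma cospectral_sym X Y : cospectral X Y -> cospectral Y X.
Proof. by move=> [c h]; split=> [|z]; [rewrite c|have [-> ->] := h z]. Qed.

Lemma cospectral_trans Y X Z : cospectral X Y -> cospectral Y Z -> cospectral X Z.
Proof.
move=> [c h] [d k]; split=> [|z]; first by rewrite c.
by have [-> ->] := h z; have [-> ->] := k z.
Qed.

Lemma cospectral_isom X Y : gisom X Y -> cospectral X Y.
Proof. by move=> XY; split; [exact: gisom_card|move=> z; apply: charval_isom]. Qed.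

Lemma cospectral_union X X' Y Y' :
  cospectral X X' -> cospectral Y Y' -> cospectral (gunion X Y) (gunion X' Y').
Proof.
move=> [c h] [d k]; split; first by rewrite !card_sum c d.
move=> z; have [-> ->] := charval_union X Y z; have [-> ->] := charval_union X' Y' z.
by have [-> ->] := h z; have [-> ->] := k z.
Qed.

Lemma cospectral_compl X Y : simple X -> simple Y ->
  cospectral X Y -> cospectral (gcompl X) (gcompl Y).
Proof.
move=> sX sY [c h]; split=> // z.
have [-> ->] := charval_compl z sX; have [-> ->] := charval_compl z sY.
by have [-> ->] := h (-1 - z); rewrite c.
Qed.

Lemma charval_union3 X z :
  charval (gunion X (gunion X (gunion X gempty))) z = charval X z ^+ 3 /\
  charvalJ (gunion X (gunion X (gunion X gempty))) z =
    charval X z ^+ 2 * (3%:R * charvalJ X z - 2%:R * charval X z).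
Proof.
have [-> ->] := charval_union X (gunion X (gunion X gempty)) z.
have [-> ->] := charval_union X (gunion X gempty) z.
have [-> ->] := charval_union X gempty z; have [-> ->] := charval_empty z.
by split; ring.
Qed.

Definition K2 := Node [:: Leaf; Leaf].
Definition K3 := Node [:: Leaf; Leaf; Leaf].
Definition C4 := Node [:: K2; K2].

Lemma charval_K3 z : charval (gtree K3) z = (z - 2%:R) * (z + 1) ^+ 2 /\
  charvalJ (gtree K3) z = (z + 1) ^+ 3.
Proof.
have [-> ->] := charval_compl z (simple_gforest [:: Leaf; Leaf; Leaf]).
rewrite card_gforest /=; have [-> ->] := charval_union3 gpoint (-1 - z).
by have [-> ->] := charval_point (-1 - z); split; rewrite /fleaves /=; ring.
Qed.

Lemma charval_C4 z : charval (gtree C4) z = z ^+ 2 * (z - 2%:R) * (z + 2%:R) /\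
  charvalJ (gtree C4) z = z ^+ 2 * (z + 2%:R) ^+ 2.
Proof.
have K2E w : charval (gtree K2) w = (w - 1) * (w + 1) /\ charvalJ (gtree K2) w = (w + 1) ^+ 2.
  have [-> ->] := charval_compl w (simple_gforest [:: Leaf; Leaf]).
  rewrite card_gforest /=.
  have [-> ->] := charval_union gpoint (gunion gpoint gempty) (-1 - w).
  have [-> ->] := charval_union gpoint gempty (-1 - w).
  have [-> ->] := charval_point (-1 - w); have [-> ->] := charval_empty (-1 - w).
  by split; rewrite /fleaves /=; ring.
have [-> ->] := charval_compl z (simple_gforest [:: K2; K2]).
rewrite card_gforest /=.
have [-> ->] := charval_union (gtree K2) (gunion (gtree K2) gempty) (-1 - z).
have [-> ->] := charval_union (gtree K2) gempty (-1 - z).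
have [-> ->] := K2E (-1 - z); have [-> ->] := charval_empty (-1 - z).
by split; rewrite /fleaves /=; ring.
Qed.

(* The hypothesis says that [charvalJ X / charval X], which encodes the walk
   generating function, is the same rational function for [X = A] and [X = B]; the
   characteristic polynomials of [A] and [B] themselves may differ. *)
Lemma cospectral_mix A B : simple A -> simple B -> #|A| = #|B| ->
  (forall z, charvalJ A z * charval B z = charval A z * charvalJ B z) ->
  cospectral (gunion (gcompl (gunion A B)) (gcompl (gunion A B)))
             (gunion (gcompl (gunion A A)) (gcompl (gunion B B))).
Proof.
move=> sA sB cAB AB; split; first by rewrite !card_sum cAB.
move=> z; have sAB := simple_union sA sB.
have sAA := simple_union sA sA; have sBB := simple_union sB sB.
have [-> ->] := charval_union (gcompl (gunion A B)) (gcompl (gunion A B)) z.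
have [-> ->] := charval_union (gcompl (gunion A A)) (gcompl (gunion B B)) z.
have [-> ->] := charval_compl z sAB; have [-> ->] := charval_compl z sAA.
have [-> ->] := charval_compl z sBB.
have [-> ->] := charval_union A B (-1 - z); have [-> ->] := charval_union A A (-1 - z).
have [-> ->] := charval_union B B (-1 - z).
rewrite !card_sum cAB addnn -mul2n exprM sqrrN !expr1n !mul1r.
move: (AB (-1 - z)); move: (charvalJ A _) (charval A _) (charvalJ B _) (charval B _).
move=> a' a b' b e.
have -> : a' * b + a * b' - a * b = 2%:R * (a' * b) - a * b by rewrite e; ring.
have h : (2%:R * (a' * b) - a * b) ^+ 2 = (a' * a + a * a' - a * a) * (b' * b + b * b' - b * b).
  have -> : (a' * a + a * a' - a * a) * (b' * b + b * b' - b * b) =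
    (2%:R * (a' * b) - a * b) * (2%:R * (a * b') - a * b) by ring.
  by rewrite -e expr2.
rewrite -expr2 h; split=> //.
have h1 : a * a * (b' * b + b * b' - b * b) = a * b * (2%:R * (a' * b) - a * b).
  by rewrite e; ring.
have h2 : (a' * a + a * a' - a * a) * (b * b) = a * b * (2%:R * (a' * b) - a * b) by ring.
by rewrite h1 h2; ring.
Qed.

(** * Mates *)

(** Three copies of [C4] and four of [K3] are both 2-regular graphs on 12 vertices, so each has
    [charvalJ] / [charval] equal to 1 + 12 / (z - 2), as [cospectral_mix] requires. The order on
    cotrees is opaque, hence the explicit sorting. *)
Definition K3C4_mix := Node (sort cotree_le (nseq 3 C4 ++ nseq 4 K3)).

Definition swap_limb := Node [:: K3C4_mix; K3C4_mix].

Definition swapped_limb :=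
  Node (sort cotree_le [:: Node (nseq 6 C4); Node (nseq 8 K3)]).

Lemma canonical_node s : (1 < size s)%N -> all canonical s ->
  canonical (Node (sort cotree_le s)).
Proof.
move=> s1 cs; rewrite /= size_sort s1 all_sort cs andbT /=.
exact: sort_sorted cotree_le_total _.
Qed.

Lemma canonical_node_nseq n t : (1 < n)%N -> canonical t -> canonical (Node (nseq n t)).
Proof. by move=> n1 ct; rewrite /= size_nseq n1 sorted_nseq all_nseq ct orbT. Qed.

Lemma canonical_K3 : canonical K3.
Proof. exact: (canonical_node_nseq (n := 3) (t := Leaf)). Qed.

Lemma canonical_C4 : canonical C4.
Proof.
by apply: (canonical_node_nseq (n := 2) (t := K2)) => //;
  apply: (canonical_node_nseq (n := 2) (t := Leaf)).
Qed.

Lemma canonical_swap_limb : canonical swap_limb.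
Proof.
apply: (canonical_node_nseq (n := 2)) => //; apply: canonical_node => //.
by rewrite all_cat !all_nseq canonical_C4 canonical_K3 !orbT.
Qed.

Lemma canonical_swapped_limb : canonical swapped_limb.
Proof.
apply: canonical_node => //; rewrite /all !andbT.
by rewrite !canonical_node_nseq ?canonical_C4 ?canonical_K3.
Qed.

(** Each child of [swapped_limb] has children of a single kind, whereas [K3C4_mix] has both kinds.
    The argument uses membership because the sorted lists do not compute. *)
Lemma swapped_limb_neq : swapped_limb != swap_limb.
Proof.
apply/eqP => -[e].
have : K3C4_mix \in [:: Node (nseq 6 C4); Node (nseq 8 K3)].
  by rewrite -(mem_sort cotree_le) e mem_head.
have mix t : t \in nseq 3 C4 ++ nseq 4 K3 -> forall s, K3C4_mix = Node s -> t \in s.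
  by move=> ts s [<-]; rewrite mem_sort.
have KC : K3 != C4 by apply/eqP => -[].
rewrite !inE => /orP[] /eqP e'.
  by have := mix K3 isT _ e'; rewrite mem_nseq (negPf KC).
by have := mix C4 isT _ e'; rewrite mem_nseq eq_sym (negPf KC).
Qed.

Lemma cospectral_swap_limb : cospectral (gtree swap_limb) (gtree swapped_limb).
Proof.
pose A := gforest (nseq 3 C4); pose B := gforest (nseq 4 K3).
have sA : simple A := simple_gforest _; have sB : simple B := simple_gforest _.
have gAB s1 s2 : gisom (gtree (Node (sort cotree_le (s1 ++ s2))))
    (gcompl (gunion (gforest s1) (gforest s2))).
  apply: gisom_compl; apply: gisom_trans (gforest_sort _) (gforest_cat _ _).
have gAA s1 s2 : gisom (gtree (Node (s1 ++ s2))) (gcompl (gunion (gforest s1) (gforest s2))).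
  by apply: gisom_compl; apply: gforest_cat.
have pair t u X Y : gisom (gtree t) X -> gisom (gtree u) Y ->
    gisom (gforest [:: t; u]) (gunion X Y).
  move=> tX uY; apply: gisom_union => //.
  by apply: gisom_trans (gisom_sym (gforest1 u)) uY.
apply: (@cospectral_compl (gforest [:: K3C4_mix; K3C4_mix])
  (gforest (sort cotree_le [:: Node (nseq 6 C4); Node (nseq 8 K3)])));
  [exact: simple_gforest|exact: simple_gforest|].
apply: cospectral_trans (cospectral_isom (pair _ _ _ _ (gAB (nseq 3 C4) (nseq 4 K3))
  (gAB (nseq 3 C4) (nseq 4 K3)))) _.
apply: cospectral_trans (cospectral_sym (cospectral_isom (gisom_trans (gforest_sort _)
  (pair _ _ _ _ (gAA (nseq 3 C4) (nseq 3 C4)) (gAA (nseq 4 K3) (nseq 4 K3)))))).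
apply: cospectral_mix => // [|z]; first by rewrite !card_gforest.
have [-> ->] := charval_union3 (gtree C4) z.
have [-> ->] := charval_union (gtree K3) (gforest (nseq 3 K3)) z.
have [-> ->] := charval_union3 (gtree K3) z.
have [-> ->] := charval_C4 z; have [-> ->] := charval_K3 z.
ring.
Qed.

Section Replacement.

Variables tau tau' : cotree.
Hypotheses (ctau : canonical tau) (ctau' : canonical tau').
Hypothesis tau_neq : tau' != tau.
Hypothesis tau_cospectral : cospectral (gtree tau) (gtree tau').

Definition has_cospectral_twin t := exists t',
  [/\ canonical t', t' != t & cospectral (gtree t) (gtree t')].

(** The new tree is put back in sorted position, so the two forests are distinguished as
    multisets. *)
Lemma forest_twin s u : sorted cotree_le s -> all canonical s -> u \in s ->
  has_cospectral_twin u -> exists s', [/\ sorted cotree_le s', all canonical s',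
    s' != s, size s' = size s & cospectral (gforest s) (gforest s')].
Proof.
move=> ss cs us [u' [cu' nu' h]]; have ps := perm_to_rem us.
exists (sort cotree_le (u' :: rem u s)); split.
- exact: sort_sorted cotree_le_total _.
- by rewrite all_sort /= cu'; apply/allP => v /mem_rem; apply: (allP cs).
- apply: contraNneq nu' => e.
  have : perm_eq (u' :: rem u s) (u :: rem u s).
    by rewrite -(permPr ps) -{2}e perm_sym perm_sort.
  move/seq.permP/(_ (pred1 u)); rewrite /= eqxx => /eqP.
  by rewrite eqn_add2r; case: (u' == u).
- by rewrite size_sort (perm_size ps).
- apply: cospectral_trans (cospectral_isom (gforest_perm ps)) _.
  apply: cospectral_trans (cospectral_sym (cospectral_isom (gforest_sort _))).
  exact: cospectral_union h (cospectral_refl _).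
Qed.

(** A node inherits a twin from the child that contains the limb; the number of children is
    unchanged, so the new node is canonical. *)
Lemma limb_twin t : canonical t -> has_limb tau t -> has_cospectral_twin t.
Proof.
elim/cotree_in_ind: t => [|s IH] ct; rewrite [has_limb _ _]/=.
  by rewrite orbF => /eqP ->; exists tau'.
case/predU1P=> [->|/hasP[u us /(IH u us) hu]]; first by exists tau'.
have [s1 ss cs] := and3P ct.
have [s' [ss' cs' ns' zs' h]] := forest_twin ss cs us (hu (allP cs u us)).
exists (Node s'); split; first by rewrite /= zs' s1 ss' cs'.
  by apply: contraNneq ns' => -[->].
exact: cospectral_compl (simple_gforest _) (simple_gforest _) h.
Qed.

End Replacement.

(** * Isomorphism classes of labelled graphs *)

Definition fingraph_of n (G : graph n) := @FinGraph 'I_n (edge G).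

Lemma simple_fingraph_of n (G : graph n) : simple (fingraph_of G).
Proof.
have /andP[/forallP ei /forallP es] := valP G; split; rewrite /edge /=.
  by move=> i j; have /forallP/(_ j)/eqP := es i.
by move=> i; apply: negbTE (ei i).
Qed.

Lemma iso_gisom n (G H : graph n) : iso G H <-> gisom (fingraph_of G) (fingraph_of H).
Proof.
split=> [[s he]|[f fb fe]].
  by exists s => //; exists s^-1%g; [exact: permK|exact: permKV].
by exists (perm (bij_inj fb)) => i j; rewrite !permE; apply: fe.
Qed.

Lemma iso_refl n (G : graph n) : iso G G.
Proof. by apply/iso_gisom/gisom_refl. Qed.

Lemma iso_classP n (G H : graph n) : iso_class G = iso_class H <-> iso G H.
Proof.
split=> [e|/iso_gisom GH].
  by have : H \in iso_class G by [rewrite e inE; apply/asboolP/iso_refl]; rewrite inE => /asboolP.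
apply/setP => K; rewrite !inE; apply/asboolP/asboolP => /iso_gisom h; apply/iso_gisom.
  exact: gisom_trans (gisom_sym GH) h.
exact: gisom_trans GH h.
Qed.

Lemma graph_of_fingraph n (X : fingraph) : simple X -> #|X| = n ->
  exists G : graph n, gisom X (fingraph_of G).
Proof.
move=> [sX iX] Xn; subst n.
pose e := [ffun ij : 'I_#|X| * 'I_#|X| => adjacent (enum_val ij.1) (enum_val ij.2)].
have se : simpleb e.
  apply/andP; split; first by apply/forallP => i; rewrite ffunE /= iX.
  by apply/forallP => i; apply/forallP => j; rewrite !ffunE /= sX.
exists (exist (fun e => simpleb e) e se); exists enum_rank; first exact: enum_rank_bij.
by move=> x y; rewrite /= /edge /= ffunE !enum_rankK.
Qed.

Lemma cograph_of_gforest n (G : graph n) s :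
  gisom (fingraph_of G) (gforest s) -> cograph G.
Proof. by move=> h; apply: (P4free_isom h); apply: P4free_gforest. Qed.

Lemma gforest_of_cograph n (G : graph n) : cograph G ->
  exists s, is_forest canonical n s /\ gisom (fingraph_of G) (gforest s).
Proof.
move=> cG; have [s [ss cs h]] := cotree_representation (simple_fingraph_of G) cG.
exists s; split=> //; rewrite /is_forest ss cs -card_gforest -(gisom_card h).
by rewrite card_ord eqxx.
Qed.

Lemma same_spec_of_charval n (G H : graph n) :
  (forall z, charval (fingraph_of G) z = charval (fingraph_of H) z) -> same_spec G H.
Proof.
move=> h z; congr (mup z _).
have horner_adj (K : graph n) y : (char_poly (adj K)).[y] = charval (fingraph_of K) y.
  have idb : bijective (id : 'I_n -> fingraph_of K) by exists id.
  rewrite horner_char_poly; have [-> _] := charvalE y idb.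
  by congr (\det (_ - _)); apply/matrixP => i j; rewrite !mxE.
apply: (@poly_ext_off_roots _ 1); first exact: oner_neq0.
by move=> y _; rewrite !horner_adj.
Qed.

Lemma gcompl_fingraph_of n (G : graph n) :
  gisom (gcompl (fingraph_of G)) (fingraph_of (compl G)).
Proof. by exists id => [|x y]; [exists id|rewrite /= /edge ffunE]. Qed.

Lemma gen_cospectral_of_cospectral n (G H : graph n) :
  cospectral (fingraph_of G) (fingraph_of H) -> gen_cospectral G H.
Proof.
move=> h; split; apply: same_spec_of_charval => z; first by have [_ /(_ z)[]] := h.
have [_ /(_ z)[hz _]] := cospectral_compl (simple_fingraph_of G) (simple_fingraph_of H) h.
have [<- _] := charval_isom z (gcompl_fingraph_of G).
by have [<- _] := charval_isom z (gcompl_fingraph_of H).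
Qed.

(** Cospectral graphs have equally many vertices, so the twin forest is realized on the same vertex
    set; an isomorphism would make the two sorted forests equal by [gforest_inj]. *)
Lemma mate_of_limb n (G : graph n) s : is_forest canonical n s ->
  gisom (fingraph_of G) (gforest s) -> ~~ all (avoids swap_limb) s ->
  has_gen_cospectral_mate G.
Proof.
move=> /and3P[ss cs /eqP sn] Gs /allPn[u us]; rewrite /avoids (allP cs) //= negbK => hu.
have [s' [ss' cs' ns' _ h]] := forest_twin ss cs us (limb_twin canonical_swapped_limb
  swapped_limb_neq cospectral_swap_limb (allP cs u us) hu).
have [H Hs] : exists H : graph n, gisom (gforest s') (fingraph_of H).
  apply: graph_of_fingraph (simple_gforest _) _.
  by have [<- _] := h; rewrite card_gforest.
exists H; split.
  move/iso_gisom => GH; case/eqP: ns'; apply: gforest_inj => //.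
  exact: gisom_trans Hs (gisom_trans (gisom_sym GH) Gs).
apply: gen_cospectral_of_cospectral.
apply: cospectral_trans (cospectral_isom Gs) _.
exact: cospectral_trans h (cospectral_isom Hs).
Qed.

Lemma size_forests_le_c_count n : (size (forests canonical n) <= c_count n)%N.
Proof.
have pick s : exists G : graph n, s \in forests canonical n -> gisom (gforest s) (fingraph_of G).
  have [sf|sf] := boolP (s \in forests canonical n); last first.
    (* The edgeless graph is the default value on lists that are not forests. *)
    have [G _] : exists G : graph n, True.
      have h : simpleb [ffun _ : 'I_n * 'I_n => false].
        apply/andP; split; apply/forallP => i; first by rewrite ffunE.
        by apply/forallP => j; rewrite !ffunE.
      by exists (exist (fun e => simpleb e) _ h).
    by exists G.
  have [G h] : exists G : graph n, gisom (gforest s) (fingraph_of G).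
    apply: graph_of_fingraph (simple_gforest _) _.
    by move: sf; rewrite (mem_forests canonical_refl) card_gforest => /and3P[_ _ /eqP].
  by exists G.
have [F FP] := boolp.choice pick.
rewrite /c_count cardE; apply: (leq_size_in (f := fun s => iso_class (F s))).
- exact: uniq_forests.
- move=> s s' sf sf' /iso_classP /iso_gisom h.
  have := FP s sf; have := FP s' sf'.
  move: sf sf'; rewrite !(mem_forests canonical_refl).
  move=> /and3P[ss cs _] /and3P[ss' cs' _] hs' hs; apply: gforest_inj => //.
  exact: gisom_trans hs (gisom_trans h (gisom_sym hs')).
- move=> s sf; rewrite mem_enum; apply/imsetP; exists (F s) => //.
  by rewrite inE; apply/asboolP/(cograph_of_gforest (gisom_sym (FP s sf))).
Qed.

(** By [mate_of_limb], a class of cographs without mate has a forest all of whose trees avoid the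
    limb, and this forest determines the class. *)
Lemma c_count_le_g_count n :
  (g_count n <= c_count n <= g_count n + size (forests (avoids swap_limb) n))%N.
Proof.
rewrite /g_count /c_count.
set M := [set iso_class G | G in [set G : graph n | `[< cograph G >] && _]].
set C := [set iso_class G | G in _].
have MC : M \subset C.
  by apply: imsetS; apply/subsetP => G; rewrite !inE => /andP[].
rewrite subset_leq_card // -leq_subLR -cardsDS // cardE.
pose good (K : {set graph n}) s := s \in forests (avoids swap_limb) n /\
  exists2 G : graph n, K = iso_class G & gisom (fingraph_of G) (gforest s).
have pick (K : {set graph n}) : exists s, K \in C :\: M -> good K s.
  have [/setDP[/imsetP[G]]|KCM] := boolP (K \in C :\: M); last by exists [::].
  rewrite inE => /asboolP cG KG KM; have [s [sf Gs]] := gforest_of_cograph cG.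
  exists s => _; split; last by exists G.
  rewrite (mem_forests (@avoids_canonical _)); move: (sf) => /and3P[ss cs sn].
  rewrite /is_forest ss sn andbT; apply: contraNT KM => sl; rewrite KG.
  apply/imsetP; exists G => //; rewrite inE; apply/andP; split; apply/asboolP => //.
  exact: mate_of_limb sf Gs sl.
have [F FP] := boolp.choice pick.
apply: (leq_size_in (f := F)) => [|K L|K]; first exact: enum_uniq.
- rewrite !mem_enum => /FP[_ [G -> Gs]] /FP[_ [H -> Hs]] e.
  apply/iso_classP/iso_gisom; apply: gisom_trans Gs _; rewrite e; exact: gisom_sym.
- by rewrite mem_enum => /FP[].
Qed.

(* g_n / c_n -> 1 as n -> oo (epsilon-N definition, ratio in rat). *)
Theorem theorem1p2 :
  forall eps : rat, 0 < eps ->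
  exists N : nat, forall n : nat, (N <= n)%N ->
    `| (g_count n)%:R / (c_count n)%:R - 1 | < eps.
Proof.
(* Halving provides the strict inequality, as [f_negligible] gives a weak one. *)
move=> eps eps0; have eps2 : 0 < eps / 2%:R by rewrite divr_gt0.
have av := @avoids_canonical swap_limb.
have [N NP] : exists N : nat, forall n, (N <= n)%N ->
    (size (forests (avoids swap_limb) n))%:R <= eps / 2%:R * (size (forests canonical n))%:R.
  apply: (f_negligible (b := fun n => size (trees (avoids swap_limb) n))
    (t := fun n => size (trees canonical n)) (m := leaves swap_limb)) => //.
  - by move=> n _; apply: forests_gt0.
  - exact: forests_convolution_le.
  - exact: forests_le_trees.
  - exact: trees_le_convolution.
  - exact: forests_avoids_le.
  - exact: leaves_gt0 canonical_swap_limb.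
  - exact: forests_avoids_lt canonical_swap_limb.
  - by move=> n n0; apply: (trees_le_forests av n0); apply: avoids_node.
  - by move=> n _; rewrite -(forests_euler av).
exists N => n Nn; have /andP[gc cg] := c_count_le_g_count n.
have fc := size_forests_le_c_count n; have f0 := forests_gt0 n.
have c0 : 0 < (c_count n)%:R :> rat by rewrite ltr0n (leq_trans f0).
rewrite distrC ger0_norm; last first.
  by rewrite subr_ge0 ler_pdivrMr // mul1r ler_nat.
rewrite ltrBlDr -ltrBlDl ltr_pdivlMr // mulrBl mul1r ltrBlDr.
move: cg; rewrite -(ler_nat rat) natrD => /le_lt_trans; apply.
rewrite ltrD2l; apply: le_lt_trans (NP n Nn) _.
apply: (@le_lt_trans _ _ (eps / 2%:R * (c_count n)%:R)).
  by rewrite ler_wpM2l ?ler_nat // ltW.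
by rewrite ltr_pM2r //; lra.
Qed.
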